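(* Let $A$ be a finite set, $x\in A$, and let $p:A\times A\to[0,\infty)$ be an integrable (nonnegative) weight. For $t>0$, the distribution $\mu_t$ of the growing loop at $x$ at time $t$ is given by $$\mu_t(l)=\frac1{G_A(x,x)^t}\,\frac{\Gamma(k+t)}{k!\,\Gamma(t)}\,p(l),\qquad l\in\tilde{\mathcal L}_x^k(A),\quad k=0,1,2,\dots$$ In particular, the distribution at time $t=1$ is given by $$\mu_1(l)=\frac{p(l)}{G_A(x,x)},\qquad l\in\tilde{\mathcal L}_x^k(A),\quad k=0,1,2,\dots$$
   Context: The weight $p$ is integrable if the matrix $[p(x,y)]_{x,y\in A}$ has spectral radius strictly less than $1$. A path in $A$ is a finite sequence $\omega=[\omega_0,\dots,\omega_n]$ of elements of $A$ (repetitions allowed, $n\ge0$), with $p(\omega)=\prod_{j=1}^np(\omega_{j-1},\omega_j)$ (equal to $1$ if $n=0$). $\mathcal K_A(x,x)$ is the set of paths from $x$ to $x$ (loops rooted at $x$), including the trivial loop $[x]$; $G_A(x,x)=\sum_{l\in\mathcal K_A(x,x)}p(l)$. An elementary loop at $x$ is a nontrivial loop in $\mathcal K_A(x,x)$ visiting $x$ only at its initial and terminal times. $\tilde{\mathcal L}_x^k(A)$ is the set of concatenations of $k$ elementary loops at $x$ (for $k=0$ it contains only $[x]$), and $\tilde{\mathcal L}_x(A)=\bigcup_{k\ge1}\tilde{\mathcal L}^k_x(A)$. Let $m'$ be the (finite) measure on $\tilde{\mathcal L}_x(A)$ given by $m'(l)=p(l)/k$ for $l\in\tilde{\mathcal L}_x^k(A)$,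 $k\ge1$. The growing loop $l(t)$, $t\ge0$, (in $A$ at $x$ induced by $p$) is the loop obtained by running independent Poisson processes, one for each $l\in\tilde{\mathcal L}_x(A)$ with rate $m'(l)$, and concatenating, in order of arrival, all loops that have arrived by time $t$ ($l(t)=[x]$ if none has). Equivalently, it is the continuous-time Markov chain on $\mathcal K_A(x,x)$ started at $[x]$ in which, for each $l\in\tilde{\mathcal L}_x(A)$, the chain jumps from $\tilde l$ to the concatenation $\tilde l\oplus l$ at rate $m'(l)$. *)

(* Defs.v *)
From HB Require Import structures.
From mathcomp Require Import all_boot all_order all_algebra.
From mathcomp Require Import finmap.
From mathcomp Require Import all_classical all_reals all_analysis.
From mathcomp Require Import complex.

Set Implicit Arguments.
Unset Strict Implicit.
Unset Printing Implicit Defensive.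

Import Order.TTheory GRing.Theory Num.Theory.
Import numFieldNormedType.Exports.
Import Normc.

Local Open Scope classical_set_scope.
Local Open Scope ring_scope.

(* The maximum of the moduli of the complex eigenvalues, for n > 0. *)
Definition spectral_radius (R : realType) (n : nat) (M : 'M[R]_n) : R :=
  sup [set normc z | z in
         [set z : R[i] | eigenvalue (map_mx (real_complex R) M) z]].

Definition integrable_weight (R : realType) (A : finType) (p : A -> A -> R) : Prop :=
  spectral_radius (\matrix_(i < #|A|, j < #|A|) p (enum_val i) (enum_val j)) < 1.

(* As in path.v, the path [w_0, ..., w_n] is given by its head w_0 and the
   sequence s = [w_1, ..., w_n].  Concatenation of loops rooted at x is then
   concatenation of sequences, and the trivial loop [x] is [::]. *)
Section Loops.
Context {A : finType}.

Definition path_weight {R : realType} (p : A -> A -> R) (y : A) (s : seq A) : R :=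
  \prod_(e <- zip (y :: s) s) p e.1 e.2.

Definition rooted_loop (x : A) (s : seq A) : bool := last x s == x.

Definition elementary_loop (x : A) (s : seq A) : bool :=
  if s is y :: s' then (last y s' == x) && (x \notin belast y s') else false.

Definition loops_of_order (x : A) (k : nat) : set (seq A) :=
  [set s | exists es : seq (seq A),
     [/\ size es = k, all (elementary_loop x) es & s = flatten es]].

Definition nontrivial_loops (x : A) : set (seq A) :=
  \bigcup_(k in [set k | (1 <= k)%N]) loops_of_order x k.

Lemma loops_of_order_count (x : A) (k : nat) (s : seq A) :
  loops_of_order x k s -> count_mem x s = k.
Proof.
case=> es [<- + ->] {k s}.
elim: es => //= -[//|y s] es IH /andP[/andP[/eqP yx xs] aes].
rewrite count_cat (IH aes) lastI -cats1 count_cat yx /= eqxx.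
by rewrite (count_memPn xs).
Qed.

Definition green {R : realType} (p : A -> A -> R) (x : A) : R :=
  fine (\esum_(l in [set s | rooted_loop x s]) (path_weight p x l)%:E)%E.

End Loops.

Definition Gamma {R : realType} (a : R) : R :=
  (\int[@lebesgue_measure R]_(s in `]0%R, +oo[) (s `^ (a - 1) * expR (- s)))%R.

Section PoissonProcesses.
Context {d : measure_display} {Omega : measurableType d} {R : realType}.
Variable P : probability Omega R.

Definition mutually_independent {I : choiceType} (D : set I)
    (F : I -> set_system Omega) : Prop :=
  forall (J : {fset I}) (E : I -> set Omega),
    [set` J] `<=` D -> (forall i, i \in J -> F i (E i)) ->
    P (\bigcap_(i in [set` J]) E i) = (\prod_(i <- J) P (E i))%E.

Definition process_sigma_algebra (X : R -> {RV P >-> nat}) : set_system Omega :=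
  <<s \bigcup_(t in [set t | 0 <= t]) g_sigma_algebra_preimage (X t) >>.

(* The second argument of poisson_prob is a dummy; for parameter 0 the law is
   the Dirac mass at 0. *)
Record poisson_process (rate : R) (X : R -> {RV P >-> nat}) : Prop := {
  poisson_start : forall w, X 0 w = 0%N ;
  poisson_nondecreasing :
    forall w (s t : R), 0 <= s -> s <= t -> (X s w <= X t w)%N ;
  poisson_right_continuous :
    forall w (t : R), 0 <= t -> \forall s \near t^'+, X s w = X t w ;
  poisson_independent_increments :
    forall t : nat -> R, 0 <= t 0%N -> {homo t : i j / (i <= j)%N >-> i <= j} ->
    mutually_independent [set: nat]
      (fun i => g_sigma_algebra_preimage
                  (fun w => (X (t i.+1) w - X (t i) w)%N)) ;
  poisson_increments :
    forall (s t : R) (n : nat), 0 <= s -> s <= t ->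
    P [set w | (X t w - X s w)%N = n] =
      poisson_prob (rate * (t - s)) 0%N [set n]
}.

End PoissonProcesses.

Section GrowingLoop.
Context {d : measure_display} {Omega : measurableType d} {R : realType}.
Context {P : probability Omega R} {A : finType}.
Variables (p : A -> A -> R) (x : A) (N : seq A -> R -> {RV P >-> nat}).

(* Only the N l with l in nontrivial_loops x matter.  By loops_of_order_count
   the order k of l is unique, so that the rate m'(l) = p(l) / k is well
   defined. *)
Definition growing_loop_clocks : Prop :=
  (forall (k : nat) (l : seq A), (1 <= k)%N -> loops_of_order x k l ->
     poisson_process (path_weight p x l / k%:R) (N l)) /\
  mutually_independent P (nontrivial_loops x)
    (fun l => process_sigma_algebra (N l)).

(* a lists, in order of arrival, the pairs (arrival time, loop) of all the
   arrivals up to time t. *)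
Definition arrivals (t : R) (w : Omega) (a : seq (R * seq A)) : Prop :=
  [/\ sorted (fun u v : R * seq A => u.1 < v.1) a,
      (forall u : R * seq A, u \in a -> 0 < u.1 <= t /\ nontrivial_loops x u.2) &
      forall l (s : R), nontrivial_loops x l -> 0 <= s <= t ->
        N l s w = count (fun u : R * seq A => (u.2 == l) && (u.1 <= s)) a].

(* The default value, the trivial loop, is used on the outcomes for which the
   arrivals up to time t cannot be listed: infinitely many, or simultaneous. *)
Definition growing_loop (t : R) (w : Omega) : seq A :=
  flatten (unzip2 (xget [::] [set a | arrivals t w a])).

Definition growing_loop_law (t : R) (l : seq A) : \bar R :=
  P [set w | growing_loop t w = l].

End GrowingLoop.

(* Main.v *)
(* Only the lower bound mu_t(l) >= ... has to be proved, because the bounds add up to 1.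
   If es = [l_1; ...; l_m] is a list of nontrivial loops, the event that exactly
   l_1, ..., l_m arrive by time t, in this order, is seen on a regular grid of
   step t / n: it contains the disjoint events prescribing at most one arrival per
   cell, whose total probability tends to e^(- t L) (t^m / m!) m'(l_1) ... m'(l_m),
   where L is the total mass of m'. These limits add up to 1 over all es.
   A loop l of order k is cut into m nontrivial loops along the compositions
   k = k_1 + ... + k_m, so the limits over the cuts of l add up to
   e^(- t L) p(l) times the coefficient of z^k in exp(- t log(1 - z)), which is
   t (t + 1) ... (t + k - 1) / k!. At t = 1 this coefficient is 1, so that summing
   over all rooted loops gives G_A(x, x) = e^L. *)

Require Import Defs.
From HB Require Import structures.
From mathcomp Require Import all_boot all_order all_algebra.
From mathcomp Require Import finmap.
From mathcomp Require Import all_classical all_reals all_analysis.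
From mathcomp Require Import measurable_realfun complex.
From mathcomp Require Import ring lra zify.

Set Implicit Arguments.
Unset Strict Implicit.
Unset Printing Implicit Defensive.

Import Order.TTheory GRing.Theory Num.Theory.
Import numFieldNormedType.Exports.

Local Open Scope classical_set_scope.
Local Open Scope ring_scope.

(** * Decompositions of a loop into nontrivial loops *)

Section LoopCombinatorics.
Context {A : finType}.
Implicit Types (x y : A) (s l : seq A) (es : seq (seq A)).

(** An upper bound for the law would need a direct proof that infinitely many or simultaneous
    arrivals have probability 0. The comparison of total masses settles this afterwards: the
    outcomes sent to the default value add nothing to the law of the trivial loop. It does require
    the events [growing_loop x N t w = l] to be measurable, although the loop is defined by a choice
    among lists. This follows from the uniqueness of the list of arrivals and from its description
    by countably many clock values, on grids of mesh t / n. Independence is given for finite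
    families of clocks, while a grid event constrains the clocks of all nontrivial loops. Its
    probability is therefore bounded below along an increasing sequence of finite sets of loops, on
    each of which the total rate is at most L. Integrability of p gives L < +oo: the entries of the
    powers of the weight matrix are summable, by Cayley-Hamilton and an induction on the
    eigenvalues. Since Gamma is given by an integral, its functional equation, finiteness and
    positivity are established as well. *)

Definition nontrivial_loop x s : bool := (s != [::]) && rooted_loop x s.

Lemma last_flatten x es : all (rooted_loop x) es -> last x (flatten es) = x.
Proof.
by elim: es => //= s es IH /andP[/eqP sx /IH {}IH]; rewrite last_cat sx.
Qed.

Lemma elementary_nontrivial x s : elementary_loop x s -> nontrivial_loop x s.
Proof. by case: s => // y s /= /andP[]. Qed.

(** Cutting at the first return to x, at position [index x s], splits off an elementary loop and
    leaves a shorter rooted loop. The number of factors is then forced by [loops_of_order_count]. *)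
Lemma rooted_loop_order x s : rooted_loop x s ->
  loops_of_order x (count_mem x s) s.
Proof.
suff: rooted_loop x s -> exists es, all (elementary_loop x) es /\ s = flatten es.
  move=> /[apply] -[es [aes ses]].
  have oes : loops_of_order x (size es) s by exists es.
  by rewrite (loops_of_order_count oes).
have [n] := ubnP (size s); elim: n s => // n IH s sn lx.
have [->|s0] := eqVneq s [::]; first by exists [::].
have xs : x \in s by case: s s0 lx {sn} => // y s _ /eqP /= {1}<-; rewrite mem_last.
have := in_take (index x s) xs; rewrite ltnn.
case/path.splitP: xs sn lx {s0} => [p1 p2] sn lx /negbT xp1.
have [||es [aes p2E]] := IH p2.
- by move: sn; rewrite size_cat size_rcons ltnS; apply: leq_trans; rewrite ltnS leq_addl.
- by move: lx; rewrite /rooted_loop last_cat last_rcons.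
exists (rcons p1 x :: es); split; last by rewrite /= p2E.
rewrite /= aes andbT; case: (p1) xp1 => [|z q] /=; first by rewrite eqxx.
by rewrite last_rcons eqxx belast_rcons.
Qed.

Lemma loops_of_orderP x k s :
  loops_of_order x k s <-> rooted_loop x s /\ count_mem x s = k.
Proof.
split=> [ls|[ls <-]]; last exact: rooted_loop_order.
split; last exact: loops_of_order_count ls.
case: ls => es [_ aes ->]; apply/eqP/last_flatten.
by apply: sub_all aes => e /elementary_nontrivial/andP[].
Qed.

Lemma count_mem_nontrivial x s : nontrivial_loop x s -> (0 < count_mem x s)%N.
Proof.
case: s => // y s /= /eqP /= lx; change (0 < count_mem x (y :: s))%N.
by rewrite -has_count has_pred1 -[X in X \in _]lx mem_last.
Qed.

Lemma nontrivial_loopsP x s : nontrivial_loops x s <-> nontrivial_loop x s.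
Proof.
split=> [[k /= k1 /loops_of_orderP[ls ck]]|ls].
  by rewrite /nontrivial_loop ls andbT; case: s ck {ls} k1 => // <-.
exists (count_mem x s); first exact: count_mem_nontrivial.
by case/andP: ls => _; exact: rooted_loop_order.
Qed.

(** An explicit duplicate-free list, so that sums over decompositions are finite sums. The index i
    runs over the visits of l to x, where the first factor may end. *)
Fixpoint loop_decompositions x m l : seq (seq (seq A)) :=
  if m is m'.+1 then
    [seq take i.+1 l :: es | i <- [seq i <- iota 0 (size l) | nth x l i == x],
                             es <- loop_decompositions x m' (drop i.+1 l)]
  else if l is [::] then [:: [::]] else [::].

Lemma mem_loop_decompositions x m l es :
  (es \in loop_decompositions x m l) =
  [&& size es == m, all (nontrivial_loop x) es & flatten es == l].
Proof.
elim: m l es => [|m IH] l es /=.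
  case: es => [|e es] /=; last by case: l.
  by case: l.
apply/allpairsPdep/idP => [[i [es' []]]|].
  rewrite mem_filter mem_iota /= add0n => /andP[nx il].
  rewrite IH => /and3P[/eqP ses aes /eqP fes] -> /=.
  rewrite ses aes fes cat_take_drop !eqxx !andbT/=.
  rewrite /nontrivial_loop -size_eq0 size_takel//=.
  by rewrite /rooted_loop (take_nth x)// last_rcons.
case: es => [|e es] //= /and3P[/eqP[ses] /andP[le aes] /eqP fl].
case: (lastP e) le fl => // e' y /andP[_]; rewrite /rooted_loop last_rcons => /eqP->.
move=> fl; exists (size e'), es; split.
- rewrite mem_filter mem_iota/= add0n -fl cat_rcons nth_cat ltnn subnn /= eqxx.
  by rewrite size_cat /= addnS ltnS leq_addr.
- by rewrite IH ses aes -fl drop_size_cat ?size_rcons ?eqxx.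
- by rewrite -fl take_size_cat ?size_rcons.
Qed.

Lemma loop_decompositions_uniq x m l : uniq (loop_decompositions x m l).
Proof.
elim: m l => [|m IH] l /=; first by case: l.
apply: allpairs_uniq_dep => //; first by rewrite filter_uniq// iota_uniq.
move=> [i es] [j es'] /allpairsPdep[i' [es1 [+ _ [-> ->]]]].
rewrite mem_filter mem_iota add0n => /and3P[_ _ il].
move=> /allpairsPdep[j' [es1' [+ _ [-> ->]]]].
rewrite mem_filter mem_iota add0n => /and3P[_ _ jl] [] /(congr1 size).
by rewrite !size_takel// => -[-> ->].
Qed.

Lemma loop_decompositions_size x m l es :
  es \in loop_decompositions x m l -> (m <= count_mem x l)%N.
Proof.
rewrite mem_loop_decompositions => /and3P[/eqP<- aes /eqP<-].
elim: es aes => //= e es IH /andP[/count_mem_nontrivial e0 /IH].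
by rewrite count_cat -add1n; exact: leq_add.
Qed.

(** The prefixes of l that end at x have orders 1, 2, ..., each occurring once. A sum over the end
    of the first factor thus becomes a sum over its order. *)
Lemma sum_prefix_count (V : nmodType) x l (f : nat -> V) :
  \sum_(i <- [seq i <- iota 0 (size l) | nth x l i == x])
     f (count_mem x (take i.+1 l)) = \sum_(1 <= j < (count_mem x l).+1) f j.
Proof.
elim/last_ind: l f => [|l y IH] f; first by rewrite big_nil big_geq.
rewrite size_rcons -addn1 iotaD filter_cat big_cat /=.
under eq_big_seq => i.
  rewrite mem_filter mem_iota add0n => /and3P[_ _ il].
  by rewrite -cats1 takel_cat //; over.
rewrite (_ : [seq i <- iota 0 (size l) | nth x (rcons l y) i == x] =
             [seq i <- iota 0 (size l) | nth x l i == x]); last first.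
  by apply: eq_in_filter => i; rewrite mem_iota add0n /= nth_rcons => ->.
rewrite IH add0n nth_rcons ltnn eqxx.
have [->|yx] := eqVneq y x; last first.
  by rewrite big_nil addr0 -cats1 count_cat /= (negbTE yx) !addn0.
rewrite big_seq1 take_oversize ?size_rcons// -cats1 count_cat /= eqxx !addn0 addn1.
by rewrite [RHS]big_nat_recr.
Qed.

End LoopCombinatorics.

(** * Loop rates and the logarithmic series *)

Section Weights.
Context {A : finType} {R : realType}.
Variable p : A -> A -> R.
Hypothesis p_ge0 : forall y z, 0 <= p y z.
Implicit Types (x y : A) (s l : seq A) (es : seq (seq A)).

Lemma path_weight_nil y : path_weight p y [::] = 1.
Proof. by rewrite /path_weight big_nil. Qed.

Lemma path_weight_cons y z s : path_weight p y (z :: s) = p y z * path_weight p z s.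
Proof. by rewrite /path_weight /= big_cons. Qed.

Lemma path_weight_cat y s1 s2 :
  path_weight p y (s1 ++ s2) = path_weight p y s1 * path_weight p (last y s1) s2.
Proof.
elim: s1 y => [|z s1 IH] y; first by rewrite path_weight_nil mul1r.
by rewrite cat_cons !path_weight_cons IH mulrA.
Qed.

Lemma path_weight_ge0 y s : 0 <= path_weight p y s.
Proof. by apply: prodr_ge0 => e _; exact: p_ge0. Qed.

Definition loop_rate x l : R := path_weight p x l / (count_mem x l)%:R.

Lemma loop_rate_ge0 x l : 0 <= loop_rate x l.
Proof. by rewrite divr_ge0// path_weight_ge0. Qed.

Lemma loop_rate_le x l : nontrivial_loop x l -> loop_rate x l <= path_weight p x l.
Proof.
move=> /count_mem_nontrivial l0; rewrite ler_pdivrMr ?ltr0n//.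
by rewrite ler_peMr ?path_weight_ge0// ler1n.
Qed.

(* The truncation at degree K of - log(1 - X); the term j = 0 vanishes since
   0^-1 = 0. *)
Definition log_poly (K : nat) : {poly R} := \poly_(j < K.+1) (j%:R)^-1.

Lemma log_poly0 K : (log_poly K)`_0 = 0.
Proof. by rewrite coef_poly /= invr0. Qed.

(** Path weights multiply when a loop is cut at x, so only the factors 1 / j depend on the cut.
    Choosing the first factor of order j is then one Cauchy product with [log_poly K]; the
    truncation is invisible up to degree K. *)
Lemma sum_loop_decompositions x m l K : rooted_loop x l -> (count_mem x l <= K)%N ->
  \sum_(es <- loop_decompositions x m l) \prod_(e <- es) loop_rate x e =
  path_weight p x l * (log_poly K ^+ m)`_(count_mem x l).
Proof.
elim: m l => [|m IH] l lx lK.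
  rewrite expr0 coef1 /=; case: l lx lK => [|y l] lx _.
    by rewrite big_seq1 big_nil path_weight_nil mulr1.
  have := @count_mem_nontrivial _ x (y :: l) lx.
  by rewrite big_nil lt0n => /negbTE ->; rewrite mulr0.
rewrite /= big_allpairs_dep exprS coefM.
rewrite -(big_mkord xpredT (fun j => (log_poly K)`_j * (log_poly K ^+ m)`_(count_mem x l - j))).
rewrite big_ltn// log_poly0 mul0r add0r.
rewrite -sum_prefix_count mulr_sumr; apply: eq_big_seq => i.
rewrite mem_filter mem_iota add0n => /and3P[/eqP nx _ il].
have ri : rooted_loop x (take i.+1 l) by rewrite /rooted_loop (take_nth x)// last_rcons nx.
have cl : (count_mem x l = count_mem x (take i.+1 l) + count_mem x (drop i.+1 l))%N.
  by rewrite -count_cat cat_take_drop.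
under eq_bigr do rewrite big_cons.
rewrite -mulr_sumr IH; first last.
- by apply: leq_trans lK; rewrite cl leq_addl.
- by move: lx; rewrite -{1}(cat_take_drop i.+1 l) /rooted_loop last_cat (eqP ri).
rewrite [in LHS]/loop_rate -[X in _ = path_weight p x X * _](cat_take_drop i.+1 l).
rewrite path_weight_cat (eqP ri) cl addKn [X in _ = _ * (X * _)]coef_poly ifT; first by ring.
by rewrite ltnS; apply: leq_trans lK; rewrite cl leq_addr.
Qed.

(* For L = log_poly K, this is read off (1 - X) (L^(m+1))' = (m+1) L^m (1 - X^K). *)
Lemma coef_log_poly_exp K m k : (k < K)%N ->
  k.+1%:R * (log_poly K ^+ m.+1)`_k.+1 =
  k%:R * (log_poly K ^+ m.+1)`_k + m.+1%:R * (log_poly K ^+ m)`_k.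
Proof.
move=> kK.
have dL : (1 - 'X) * (log_poly K)^`() = 1 - 'X^K.
  have -> : (log_poly K)^`() = \sum_(j < K) 'X^j.
    transitivity (\poly_(j < K) (1 : R)); last first.
      by rewrite poly_def; apply: eq_bigr => j _; rewrite scale1r.
    apply/polyP => i; rewrite coef_deriv !coef_poly ltnS.
    by case: ifP => _; rewrite ?mul0rn// -[LHS]mulr_natr mulVf// pnatr_eq0.
  by rewrite -opprB mulNr -subrX1 opprB.
have : ((1 - 'X) * (log_poly K ^+ m.+1)^`())`_k =
       (log_poly K ^+ m *+ m.+1 * (1 - 'X^K))`_k.
  by congr (polyseq _)`_k; rewrite deriv_exp -dL mulrnAl mulrnAr mulrA [_ * log_poly K ^+ _]mulrC.
rewrite mulrBl mul1r coefB coefXM coef_deriv.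
rewrite mulrBr mulr1 coefB coefMXn kK subr0 coefMn => E.
rewrite !mulr_natl -E; case: k kK {E} => [|k] _ /=; first by rewrite mulr0n; ring.
by rewrite coef_deriv; ring.
Qed.


Lemma log_poly_exp_small K m k : (k < m)%N -> (log_poly K ^+ m)`_k = 0.
Proof.
elim: m k => // m IH k km; rewrite exprS coefM big1 // => -[[|j] jk] _ /=.
  by rewrite log_poly0 mul0r.
by rewrite IH ?mulr0//; lia.
Qed.

(* The coefficient of X^k in exp(- t log(1 - X)) = (1 - X)^(-t). *)
Lemma sum_log_poly_exp t K k : (k <= K)%N ->
  \sum_(m < K.+1) t ^+ m / m`!%:R * (log_poly K ^+ m)`_k =
  \prod_(i < k) (i%:R + t) / k`!%:R.
Proof.
elim: k => [|k IH] kK.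
  rewrite big_ord0 fact0 divr1 big_ord_recl big1 => [|m _].
    by rewrite expr0 expr0 coef1 fact0 divr1 mulr1 addr0.
  by rewrite log_poly_exp_small ?mulr0.
rewrite [in RHS]big_ord_recr/=.
have k0 : k.+1%:R != 0 :> R by rewrite pnatr_eq0.
apply: (mulfI k0); rewrite factS natrM.
have -> : k.+1%:R * (\prod_(i < k) (i%:R + t) * (k%:R + t) / (k.+1%:R * k`!%:R)) =
  (k%:R + t) * (\prod_(i < k) (i%:R + t) / k`!%:R).
  have f0 : k`!%:R != 0 :> R by rewrite pnatr_eq0 -lt0n fact_gt0.
  by move: (k.+1%:R) k0 (k`!%:R) f0 => c c0 f f0; field; rewrite c0 f0.
rewrite -IH 1?ltnW// mulrDl !mulr_sumr.
(* The sum multiplied by t is shifted by one in m. Its last term, m = K, vanishes because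
   [log_poly K ^+ K] has no coefficient below degree K; the terms m = 0 of the other two sums vanish
   as well. *)
rewrite big_ord_recl [X in _ = X + _]big_ord_recl [X in _ = _ + X]big_ord_recr/=.
rewrite (log_poly_exp_small _ kK) !mulr0 addr0 !expr0 !coef1 !mulr0 add0r.
have -> : k%:R * (1 / 0`!%:R * (k == 0%N)%:R) = 0 :> R.
  by case: (k) => [|?]; rewrite ?mul0r// !mulr0.
rewrite add0r -big_split/=; apply: eq_bigr => m _; rewrite /bump/= add1n.
rewrite mulrCA coef_log_poly_exp// factS natrM exprS.
have f0 : m`!%:R != 0 :> R by rewrite pnatr_eq0 -lt0n fact_gt0.
have m0 : m.+1%:R != 0 :> R by rewrite pnatr_eq0.
by move: (m.+1%:R) m0 (m`!%:R) f0 => c c0 f f0; field; rewrite c0 f0.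
Qed.

End Weights.

(** * Finiteness of the Green function *)

Section SpectralRadius.
Context {R : realType}.
Import Normc.

Definition bounded_sums (u : nat -> R[i]) : Prop :=
  exists U : R, forall n, \sum_(k < n) normc (u k) <= U.

Lemma normc_ge0 (z : R[i]) : 0 <= normc z.
Proof. by case: z => a b; exact: sqrtr_ge0. Qed.

(** With S_n the partial sums of |u_k|, the recursion gives S_(n+1) <= |u_0| + |r| S_n + V. Since
    S_n <= S_(n+1) and |r| < 1, the term |r| S_n is absorbed on the left. *)
Lemma bounded_sums_shift (u v : nat -> R[i]) (r : R[i]) : normc r < 1 ->
  (forall n, u n.+1 = r * u n + v n) -> bounded_sums v -> bounded_sums u.
Proof.
move=> r1 uS [V Vv]; exists ((normc (u 0%N) + V) / (1 - normc r)) => n.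
rewrite ler_pdivlMr ?subr_gt0// mulrBr mulr1 lerBlDr.
have u_ge0 k : 0 <= \sum_(i < k) normc (u i) by apply: sumr_ge0 => i _; exact: normc_ge0.
have : \sum_(k < n.+1) normc (u k) <=
    normc (u 0%N) + (\sum_(k < n) normc (u k) * normc r + V).
  rewrite big_ord_recl lerD2l/= (le_trans _ (lerD (lexx _) (Vv n)))//.
  rewrite -big_split/=; apply: ler_sum => k _.
  by rewrite /bump/= add1n uS (le_trans (le_normcD _ _))// normcM mulrC.
rewrite -mulr_suml addrA addrAC; apply: le_trans.
by rewrite big_ord_recr/= lerDl normc_ge0.
Qed.

(* The linear factors of a polynomial annihilating M are peeled off one by one. *)
Lemma bounded_sums_powers n (M : 'M[R[i]]_n.+1) (rs : seq R[i]) (q : {poly R[i]}) :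
  {in rs, forall r, normc r < 1} ->
  horner_mx M (q * \prod_(r <- rs) ('X - r%:P)) = 0 ->
  forall i j, bounded_sums (fun k => (horner_mx M q * M ^+ k) i j).
Proof.
elim: rs q => [|r rs IH] q rs1 qM i j.
  exists 0 => k; rewrite big1// => l _.
  by move: qM; rewrite big_nil mulr1 => ->; rewrite mul0r mxE normc0.
have rs1' : {in rs, forall r, normc r < 1}.
  by move=> s srs; apply: rs1; rewrite inE srs orbT.
(* From q(M) M^(k+1) = r q(M) M^k + q(M) (M - r) M^k: the last term is the sequence attached to q (X
   - r), covered by the induction hypothesis. *)
apply: (bounded_sums_shift (r := r) _ _ (IH (q * ('X - r%:P)) rs1' _ i j)).
- by apply: rs1; rewrite inE eqxx.
- move=> k; rewrite rmorphM rmorphB /= horner_mx_X horner_mx_C.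
  rewrite mulrBr mulrBl -!mulrA -exprS.
  rewrite [X in _ = _ + X]mxE [X in _ = _ + (_ + X)]mxE.
  rewrite mulrA -[_ * r%:M]/(_ *m _) mul_mx_scalar -scalerAl.
  by rewrite [X in _ - X]mxE addrC subrK.
- by rewrite -mulrA -(big_cons _ _ _ _ xpredT (fun r => 'X - r%:P)).
Qed.

(** Over R[i] the characteristic polynomial splits and annihilates the matrix, so peeling off its
    roots takes the place of the Jordan form or of Gelfand's formula. *)
Lemma spectral_radius_lt1_bounded n (M : 'M[R]_n) : spectral_radius M < 1 ->
  forall i j, exists U : R, forall m, \sum_(k < m) `|(M ^+ k) i j| <= U.
Proof.
case: n M => [|n] M; first by move=> _ [].
set C := map_mx (real_complex R) M => rM i j.
have [rs charE] := closed_field_poly_normal (char_poly C).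
rewrite (monicP (char_poly_monic C)) scale1r in charE.
have eig_rs r : r \in rs -> eigenvalue C r.
  by rewrite eigenvalue_root_char charE root_prod_XsubC.
have rs1 : {in rs, forall r, normc r < 1}.
  move=> r /eig_rs er; apply: le_lt_trans rM; apply: ub_le_sup; last by exists r.
  (* Each modulus is at most [sup] only once the set of moduli is known to be bounded; the sum of
     the moduli of all roots is a bound. *)
  exists (\sum_(s <- rs) normc s) => _ [s /= es <-].
  move: es; rewrite eigenvalue_root_char charE root_prod_XsubC => srs.
  rewrite (big_rem s)//= lerDl; apply: sumr_ge0 => z _; exact: normc_ge0.
have C0 : horner_mx C (1 * \prod_(r <- rs) ('X - r%:P)) = 0.
  by rewrite mul1r -charE Cayley_Hamilton.
have [U HU] := bounded_sums_powers rs1 C0 i j.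
exists U => m; apply: le_trans (HU m); apply: ler_sum => k _.
rewrite rmorph1 mul1r -[C ^+ k](rmorphXn (map_mx (real_complex R))) mxE.
by rewrite /normc /= expr0n /= addr0 sqrtr_sqr.
Qed.

End SpectralRadius.

(** * Scaling of nonnegative sums *)

Section EsumScale.
Context {R : realType} {T : choiceType}.
Local Open Scope ereal_scope.

(** The inequality <= for every scalar suffices: applied to c^-1 and to the family c * a, it gives
    the reverse one. *)
Lemma esumZl (I : set T) (a : T -> \bar R) (c : R) :
  (0 <= c)%R -> (forall i, 0 <= a i) ->
  \esum_(i in I) (c%:E * a i) = c%:E * \esum_(i in I) a i.
Proof.
move=> c0 a0.
have le (b : T -> \bar R) (e : R) : (0 <= e)%R -> (forall i, 0 <= b i) ->
    \esum_(i in I) (e%:E * b i) <= e%:E * \esum_(i in I) b i.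
  move=> e0 b0; apply: ge_ereal_sup => _ [X XI <-].
  rewrite -ge0_mule_fsumr// lee_wpmul2l ?lee_fin//.
  by apply: ereal_sup_ubound; exists X.
apply/eqP; rewrite eq_le le//=.
have [->|cn0] := eqVneq c 0%R.
  by rewrite mul0e; apply: esum_ge0 => i _; rewrite mul0e.
have cgt0 : (0 < c)%R by rewrite lt_neqAle eq_sym cn0.
have := le (fun i => c%:E * a i) c^-1%R; rewrite invr_ge0 => /(_ c0)H.
have {H} := H (fun i => mule_ge0 (c0 : 0 <= c%:E) (a0 i)).
under eq_esum do rewrite muleA -EFinM mulVf// mul1e.
move=> H; apply: (le_trans (lee_wpmul2l _ H)); first by rewrite lee_fin.
by rewrite muleA -EFinM divff// mul1e.
Qed.


Lemma esum_seq (r : seq T) (a : T -> \bar R) : uniq r ->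
  (forall i, 0 <= a i) -> \esum_(i in [set` r]) a i = \sum_(i <- r) a i.
Proof. by move=> ur a0; rewrite (fsbig_seq _ a ur) esum_fset.
Qed.

End EsumScale.

(** * Walks and powers of the weight matrix *)

Section GreenFinite.
Context {A : finType} {R : realType}.
Variable p : A -> A -> R.
Hypothesis p_ge0 : forall y z, 0 <= p y z.

Let M : 'M[R]_#|A| := \matrix_(i, j) p (enum_val i) (enum_val j).

Lemma esum_walks k (y z : A) :
  (\esum_(s in [set s : seq A | size s = k /\ last y s = z]) (path_weight p y s)%:E =
  ((M ^+ k) (enum_rank y) (enum_rank z))%:E)%E.
Proof.
elim: k y => [|k IH] y.
  have [->|yz] := eqVneq y z.
    rewrite (_ : [set s | _] = [set [::]]); last first.
      by apply/seteqP; split => [s [/size0nil]|_ ->].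
    rewrite esum_set1 ?path_weight_nil ?lee_fin//.
    by rewrite expr0 mxE eqxx.
  rewrite (_ : [set s | _] = set0); last first.
    by apply/seteqP; split => // s [/size0nil -> /= /eqP]; rewrite (negbTE yz).
  by rewrite esum_set0 expr0 mxE (inj_eq enum_rank_inj) (negbTE yz).
pose J (w : A) := [set s : seq A | size s = k /\ last w s = z].
rewrite (@reindex_esum _ _ _ ([set: A] `*`` J) _ (fun u => u.1 :: u.2)); last first.
  split.
  - by move=> [w s] [_ /= [<- <-]].
  - by move=> [w s] [w' s'] _ _ [-> ->].
  - by move=> [|w s] [] //= [sk] wz; exists (w, s).
under eq_esum do rewrite path_weight_cons.
rewrite -(esum_esum (a := fun w s => (p y w * path_weight p w s)%:E)); last first.
  by move=> *; rewrite lee_fin mulr_ge0// path_weight_ge0.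
rewrite (_ : [set: A] = [set` enum A]); last first.
  by apply/seteqP; split => // w _ /=; rewrite mem_enum.
rewrite esum_seq ?enum_uniq//; last first.
  by move=> w; apply: esum_ge0 => s _; rewrite lee_fin mulr_ge0// path_weight_ge0.
under eq_bigr => w _.
  under eq_esum do rewrite EFinM.
  rewrite esumZl// ?IH; last by move=> s; rewrite lee_fin path_weight_ge0.
  rewrite -EFinM; over.
rewrite sumEFin big_enum/= exprS mxE (reindex (enum_rank : A -> _)); last first.
  by apply: onW_bij; exact: enum_rank_bij.
by congr (_%:E); apply: eq_bigr => w _; rewrite mxE !enum_rankK.
Qed.

(** Grouped by length, the loops of length k contribute the diagonal entry of M^k at x, and the
    partial sums of these entries are bounded. *)
Lemma esum_rooted_loops_fin (x : A) : integrable_weight p ->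
  (\esum_(s in [set s | rooted_loop x s]) (path_weight p x s)%:E < +oo)%E.
Proof.
move=> pint; have [U HU] := spectral_radius_lt1_bounded pint (enum_rank x) (enum_rank x).
have w_ge0 s : (0 <= (path_weight p x s)%:E)%E by rewrite lee_fin path_weight_ge0.
rewrite (_ : [set s | _] =
    \bigcup_k [set s : seq A | size s = k /\ last x s = x]); last first.
  apply/seteqP; split => [s /eqP sx|s [k _ [_ sx]]]; last exact/eqP.
  by exists (size s).
rewrite nneseries_sum_bigcup//; last first.
  apply/trivIsetP => i j _ _ /eqP ij; apply/seteqP; split => // s [[si _] [sj _]].
  by apply: ij; rewrite -si -sj.
apply: (@le_lt_trans _ _ U%:E); last exact: ltry.
apply: lime_le; first by apply: is_cvg_nneseries => n _ _; apply: esum_ge0.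
apply: nearW => n; under eq_bigr do rewrite esum_walks.
rewrite sumEFin lee_fin big_mkord; apply: le_trans (HU n).
by apply: ler_sum => k _; rewrite ler_norm.
Qed.


End GreenFinite.

(** * The Gamma function *)

Section Gamma.
Context {R : realType}.
Local Notation mu := (@lebesgue_measure R).
Implicit Types a s : R.

Let g a s : R := s `^ (a - 1) * expR (- s).
Let H a s : R := s `^ a * expR (- s).
(** Compact intervals away from 0, where the powers are smooth. The shift by 2 keeps the end points
    distinct even for n = 0. *)
Let itv n := `[(n.+2%:R)^-1 : R, n.+2%:R]%classic.

Let g_ge0 a s : 0 <= g a s.
Proof. by rewrite mulr_ge0 ?powR_ge0 ?expR_ge0. Qed.

Let itv_gt0 n s : itv n s -> 0 < s.
Proof.
by rewrite /itv /= in_itv /= => /andP[+ _]; apply: lt_le_trans; rewrite invr_gt0.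
Qed.

Let measurable_g a (D : set R) : measurable D -> measurable_fun D (g a).
Proof.
move=> mD; apply: measurable_funTS.
apply: measurable_funM; first exact: measurable_powR.
by apply: measurableT_comp; [exact: measurable_expR|exact: oppr_measurable].
Qed.

Let continuous_powR a s : 0 < s -> {for s, continuous (fun s => s `^ a)}.
Proof.
move=> s0; apply: differentiable_continuous; apply/derivable1_diffP.
by apply: derivable_powR; rewrite in_itv/= s0.
Qed.

(* The boundary terms are placed so that no subtraction occurs in \bar R, where
   the integrals are not yet known to be finite. *)
Let itv_by_parts n a : 0 < a ->
  (\int[mu]_(s in itv n) (g (a + 1) s)%:E + (H a n.+2%:R)%:E =
   (H a n.+2%:R^-1)%:E + \int[mu]_(s in itv n) (a * g a s)%:E)%E.
Proof.
move=> a_gt0; have n1 : 1 < n.+2%:R :> R by rewrite ltr1n.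
have ab : (n.+2%:R)^-1 < n.+2%:R :> R by rewrite (lt_trans _ n1)// invf_lt1// (lt_trans _ n1).
have a0 : 0 < (n.+2%:R)^-1 :> R by rewrite invr_gt0.
have b0 : 0 < n.+2%:R :> R by [].
have dexp s : derivable (fun s : R => - expR (- s)) s 1 by exact: ex_derive.
have cexp s : {for s, continuous (fun s : R => expR (- s))}.
  by apply: continuous_comp; [exact: oppr_continuous|exact: continuous_expR].
rewrite (@eq_integral _ _ _ mu _ (fun s => (s `^ a * expR (- s))%:E)) => [|s _]; last first.
  by rewrite /g addrK.
rewrite (@integration_by_parts R (fun s => s `^ a) (fun s => - expR (- s))
  (fun s => a * s `^ (a - 1)) (fun s => expR (- s)))//; first last.
- move=> s _; rewrite derive1N; last exact: ex_derive.
  rewrite (derive1_comp (g := expR)) ?derive1N// derive1_id.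
  by rewrite derive1E derive_val mulrN1 opprK.
- split.
  + by move=> s _; exact: dexp.
  + by apply: cvg_at_right_filter; apply: cvgN; exact: cexp.
  + by apply: cvg_at_left_filter; apply: cvgN; exact: cexp.
- by apply: continuous_in_subspaceT => s _; exact: cexp.
- move=> s; rewrite in_itv/= => /andP[s0 _]; apply: powR_derive1.
  by rewrite in_itv/= andbT (lt_trans a0).
- split.
  + move=> s; rewrite in_itv/= => /andP[s0 _]; apply: derivable_powR.
    by rewrite in_itv/= andbT (lt_trans a0).
  + by apply: cvg_at_right_filter; exact: continuous_powR.
  + by apply: cvg_at_left_filter; exact: continuous_powR.
- apply: continuous_in_subspaceT => s; rewrite inE => /itv_gt0 s0.
  by apply: cvgM; [exact: cvg_cst|exact: continuous_powR].
rewrite (@eq_integral _ _ _ mu _ (fun s => - (a * g a s)%:E)%E) => [|s _]; last first.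
  by rewrite /g mulrN mulrA.
rewrite integral_ge0N; last by move=> s _; rewrite lee_fin mulr_ge0 ?g_ge0 ?ltW.
by rewrite oppeK addeAC -EFinD /H; congr (_%:E + _)%E; ring.
Qed.

Let itv_nondecreasing : nondecreasing_seq itv.
Proof.
move=> m n mn; apply/subsetPset => s; rewrite /itv/= !in_itv/= => /andP[ms sm].
rewrite (le_trans _ ms) ?(le_trans sm) ?ler_nat//.
by rewrite lef_pV2 ?posrE// ler_nat.
Qed.

Let bigcup_itv : \bigcup_n itv n = `]0, +oo[%classic.
Proof.
apply/seteqP; split => [s [n _ /itv_gt0 s0]|s /=].
  by rewrite /= in_itv/= andbT.
rewrite in_itv/= andbT => s0.
exists (Num.truncn (Num.max s s^-1)) => //; rewrite /itv/= in_itv/=.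
have : Num.max s s^-1 <= (Num.truncn (Num.max s s^-1)).+2%:R.
  by rewrite (le_trans (ltW (truncnS_gt _)))// ler_nat.
rewrite ge_max => /andP[-> /=]; rewrite andbT => sn.
by rewrite -[leRHS]invrK lef_pV2 ?posrE ?invr_gt0.
Qed.

Let cvg_itv (f : R -> R) : measurable_fun setT f -> (forall s, 0 <= f s) ->
  (\int[mu]_(s in itv n) (f s)%:E @[n --> \oo] -->
   \int[mu]_(s in `]0%R, +oo[) (f s)%:E)%E.
Proof.
move=> mf f0; rewrite -bigcup_itv; apply: ge0_nondecreasing_set_cvg_integral => //.
- by move=> n; exact: measurable_itv.
- by move=> n; apply/measurable_EFinP; exact: measurable_funTS.
- by move=> n s _; rewrite lee_fin.
Qed.

Let H_cvg0 a : 0 < a -> H a n.+2%:R^-1 @[n --> \oo] --> 0.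
Proof.
move=> a0; have c0 : n.+2%:R^-1 @[n --> \oo] --> (0 : R).
  rewrite (_ : (fun n => _) = (fun n => harmonic (n + 1)%N)); last first.
    by apply/funext => n; rewrite /harmonic addn1.
  by rewrite cvg_shiftn; exact: cvg_harmonic.
rewrite -(mul0r (expR (- 0))); apply: cvgM.
  have /cvg_at_rightP := powR_cvg0 a0; apply; split => //.
apply: (@continuous_cvg _ _ _ _ _ _ expR); last exact: cvgN.
exact: continuous_expR.
Qed.

(** If a <= m + 1, then e^y >= y^(m+2) / (m+2)! yields y^a e^(-y) <= (m+2)! / y, here with y = n +
    2. *)
Let H_cvgy a : 0 < a -> H a n.+2%:R @[n --> \oo] --> 0.
Proof.
move=> a0; pose m := Num.truncn a.
have am : a <= m.+1%:R by rewrite ltW// truncnS_gt.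
apply: (@squeeze_cvgr _ _ _ _ (cst 0) (fun n => m.+2`!%:R * harmonic n)).
- apply: nearW => n; rewrite mulr_ge0 ?powR_ge0 ?expR_ge0//=.
  rewrite /H expRN ler_pdivrMr ?expR_gt0//.
  have /le_trans -> // : n.+2%:R `^ a <= n.+2%:R ^+ m.+1 :> R.
    by rewrite -powR_mulrn// ler_powR// ler1n.
  have /(le_trans _) -> // : m.+2`!%:R * harmonic n * (n.+2%:R ^+ m.+2 / m.+2`!%:R) <=
      m.+2`!%:R * harmonic n * expR n.+2%:R :> R.
    rewrite ler_pM2l ?mulr_gt0 ?harmonic_gt0 ?ltr0n ?fact_gt0//.
    have := @expR_ge1Dxn R n.+2%:R m.+1 (ler0n _ _).
    by apply: le_trans; rewrite lerDr.
  rewrite mulrC -mulrA [_^-1 * _]mulrA mulVf ?mul1r; last by rewrite pnatr_eq0 -lt0n fact_gt0.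
  rewrite /harmonic [_ ^+ m.+2]exprSr -mulrA ler_peMr ?exprn_ge0//.
  by rewrite ler_pdivlMr// mul1r ler_nat.
- exact: cvg_cst.
- by rewrite -(mulr0 (m.+2`!%:R)); apply: cvgM; [exact: cvg_cst|exact: cvg_harmonic].
Qed.

Let E a := (\int[mu]_(s in `]0%R, +oo[) (g a s)%:E)%E.

(** The limit of the integration by parts over [itv n]. It is stated in \bar R because the
    finiteness of [E] is itself deduced from it. *)
Let E_rec a : 0 < a -> E (a + 1) = (a%:E * E a)%E.
Proof.
move=> a0.
rewrite /E -ge0_integralZl_EFin//; first last.
- by rewrite ltW.
- by apply/measurable_EFinP; exact: measurable_g.
- by move=> s _; rewrite lee_fin.
have c1 := cvg_itv (measurable_g (a + 1) measurableT) (g_ge0 (a + 1)).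
have mag : measurable_fun setT (fun s => a * g a s).
  by apply: measurable_funM => //; exact: measurable_g.
have c2 := cvg_itv mag (fun s => mulr_ge0 (ltW a0) (g_ge0 a s)).
have l1 : (\int[mu]_(s in itv n) (g (a + 1) s)%:E + (H a n.+2%:R)%:E
    @[n --> \oo] --> E (a + 1) + 0)%E.
  apply: cvgeD; [exact: fin_num_adde_defl|exact: c1|].
  by apply: cvg_EFin; [exact: nearW|exact: H_cvgy].
have l2 : ((H a n.+2%:R^-1)%:E + \int[mu]_(s in itv n) (a * g a s)%:E
    @[n --> \oo] --> 0 + \int[mu]_(s in `]0%R, +oo[) (a * g a s)%:E)%E.
  apply: cvgeD; [exact: fin_num_adde_defr| |exact: c2].
  by apply: cvg_EFin; [exact: nearW|exact: H_cvg0].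
rewrite adde0 add0e in l1 l2.
rewrite (funext (fun n => itv_by_parts n a0)) in l1.
exact: cvg_unique l1 l2.
Qed.

Let E_ge0 a : (0 <= E a)%E.
Proof. by apply: integral_ge0 => s _; rewrite lee_fin. Qed.

Let E1_fin : (E 1 < +oo)%E.
Proof.
apply: (@le_lt_trans _ _ 1%E); last exact: ltry.
rewrite -(@integral_exponential_pdf R 1 ltr01).
rewrite /E (@eq_integral _ _ _ mu _ (fun s => (exponential_pdf 1 s)%:E)) => [|s].
  apply: ge0_subset_integral => //.
    by apply/measurable_EFinP; exact: measurable_exponential_pdf.
  by move=> s _; rewrite lee_fin exponential_pdf_ge0.
rewrite inE/= in_itv/= andbT => s0.
by rewrite exponential_pdfE ?ltW// /g subrr powRr0 mulN1r.
Qed.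

Let E_fin_nat n : (E n.+1%:R < +oo)%E.
Proof.
elim: n => [//|n IH]; rewrite -natr1 E_rec ?ltr0n// lte_mul_pinfty ?lee_fin//.
Qed.

(** For b >= 1 and n >= b - 1, the bound s^(b-1) <= 1 + s^n compares E b with E 1 + E (n + 1). A
    general a > 0 is reached through a * E a = E (a + 1). *)
Let E_fin a : 0 < a -> (E a < +oo)%E.
Proof.
have fin1 b : 1 <= b -> (E b < +oo)%E.
  move=> b1; pose n := Num.truncn b.
  have bn : b - 1 <= n%:R by rewrite lerBlDr natr1 ltW// truncnS_gt.
  apply: (@le_lt_trans _ _ (E 1 + E n.+1%:R)%E); last by rewrite lte_add_pinfty.
  rewrite -ge0_integralD//; first last.
  - by apply/measurable_EFinP; exact: measurable_g.
  - by move=> s _; rewrite lee_fin.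
  - by apply/measurable_EFinP; exact: measurable_g.
  - by move=> s _; rewrite lee_fin.
  apply: ge0_le_integral => //.
  - by move=> s _; rewrite lee_fin.
  - by apply/measurable_EFinP; exact: measurable_g.
  - by apply: emeasurable_funD; apply/measurable_EFinP; exact: measurable_g.
  move=> s; rewrite /= in_itv/= andbT => s0.
  rewrite -EFinD lee_fin /g -mulrDl ler_pM2r ?expR_gt0// subrr powRr0 -natr1 addrK.
  have [s1|/ltW s1] := leP s 1.
    rewrite (@le_trans _ _ 1)// ?lerDl ?powR_ge0//.
    have := @ge0_ler_powR R (b - 1) _ s 1; rewrite powR1 subr_ge0 !nnegrE.
    by apply => //; exact: ltW.
  by rewrite (@le_trans _ _ (s `^ n%:R))// ?lerDr ?ler_powR.
move=> a0.
have fin_mul (e : \bar R) : (0 <= e -> a%:E * e < +oo -> e < +oo)%E.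
  case: e => [r _ _|_|//]; first exact: ltry.
  by rewrite mulry gtr0_sg// mul1e.
apply: fin_mul; first exact: E_ge0.
by rewrite -(E_rec a0); apply: fin1; rewrite lerDr; exact: ltW.
Qed.

(** For b >= 1 the integrand is at least e^(-2) on [1, 2]; the recurrence then brings a + 1 down to
    a. *)
Let E_gt0 a : 0 < a -> (0 < E a)%E.
Proof.
have pos1 b : 1 <= b -> (0 < E b)%E.
  move=> b1; apply: (@lt_le_trans _ _ (\int[mu]_(s in `[1%R, 2%R]) (expR (- 2))%:E)%E).
    rewrite integral_cst//= lebesgue_measure_itv/= lte_fin ltr1n/=.
    by rewrite -EFinD -EFinM lte_fin mulr_gt0 ?expR_gt0// subr_gt0 ltr1n.
  apply: (@le_trans _ _ (\int[mu]_(s in `[1%R, 2%R]) (g b s)%:E)%E).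
    apply: ge0_le_integral => //.
    - by apply/measurable_EFinP; exact: measurable_g.
    move=> s; rewrite /= in_itv/= => /andP[s1 s2]; rewrite lee_fin /g.
    rewrite -[leLHS]mul1r ler_pM ?expR_ge0// ?ler_expR ?lerN2//.
    by rewrite -[leLHS](powRr0 s) ler_powR// subr_ge0.
  apply: ge0_subset_integral => //.
  - by apply/measurable_EFinP; exact: measurable_g.
  - by move=> s _; rewrite lee_fin.
  - by move=> s; rewrite /= !in_itv/= andbT => /andP[s1 _]; rewrite (lt_le_trans _ s1).
move=> a0; have := pos1 (a + 1); rewrite lerDr => /(_ (ltW a0)).
by rewrite E_rec// pmule_rgt0.
Qed.

Lemma Gamma_gt0 a : 0 < a -> 0 < Gamma a.
Proof. by move=> a0; apply: fine_gt0; rewrite (E_gt0 a0) (E_fin a0). Qed.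

Lemma GammaS a : 0 < a -> Gamma (a + 1) = a * Gamma a.
Proof.
move=> a0; rewrite /Gamma /Rintegral -/(E a) -/(E (a + 1)) E_rec// fineM//.
by rewrite fin_numElt (lt_trans _ (E_gt0 a0)) ?E_fin.
Qed.

Lemma Gamma_natD k a : 0 < a ->
  Gamma (k%:R + a) = \prod_(i < k) (i%:R + a) * Gamma a.
Proof.
move=> a0; elim: k => [|k IH]; first by rewrite add0r big_ord0 mul1r.
have ka : 0 < k%:R + a by rewrite ltr_wpDl.
by rewrite -natr1 addrAC (GammaS ka) IH big_ord_recr/= mulrCA mulrA.
Qed.

End Gamma.

(** * Arrivals on a grid *)

Lemma count_lt_mem (T : eqType) (P Q : pred T) (s : seq T) (u : T) :
  u \in s -> Q u -> ~~ P u -> {in s, forall v, P v -> Q v} -> (count P s < count Q s)%N.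
Proof.
move=> us Qu Pu PQ; have := count_predUI P (pred1 u) s.
rewrite [count (predI _ _) s](@eq_in_count _ _ pred0) ?count_pred0 => [|v vs /=]; last first.
  by case: eqP => [->|]; rewrite ?andbF// (negbTE Pu).
have : (0 < count_mem u s)%N by rewrite -has_count has_pred1.
suff : (count (predU P (pred1 u)) s <= count Q s)%N by lia.
rewrite (@eq_in_count _ _ (predI Q (predU P (pred1 u)))) => [|v vs /=].
  by apply: sub_count => v /andP[].
by case Pv : (P v) => /=; [rewrite PQ|case: eqP => [->|]; rewrite ?Qu ?andbF].
Qed.

Section JumpTimes.
Context {R : realType}.

(** The jump occurs at the infimum of the times in [a, b] where X equals k + 1. Right continuity
    makes this infimum attained, so the new value already holds at the jump time. *)
Lemma jump_time (X : R -> nat) (a b : R) (k : nat) : a < b ->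
  (forall s t, a <= s -> s <= t -> (X s <= X t)%N) ->
  (forall t, a <= t -> \forall s \near t^'+, X s = X t) ->
  X a = k -> X b = k.+1 ->
  exists s, [/\ a < s <= b, forall r, a <= r < s -> X r = k &
                forall r, s <= r <= b -> X r = k.+1].
Proof.
move=> ab Xmono Xrc Xa Xb; pose S := [set r | a <= r <= b /\ X r = k.+1].
have Sb : S b by split; rewrite ?lexx ?andbT ?ltW.
have lbS : has_lbound S by exists a => r [/andP[]].
have infS : has_inf S by split => //; exists b.
pose s := inf S.
have as_ : a <= s by apply: lb_le_inf; [exists b|move=> r [/andP[]]].
have sb : s <= b by exact: ge_inf.
have Xs : X s = k.+1.
  have [e /= e0 He] := Xrc s as_.
  have [r Sr rs] := inf_adherent e0 infS.
  have sr : s <= r by exact: ge_inf.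
  move: sr; rewrite le_eqVlt => /predU1P[->|sr]; first by case: Sr.
  rewrite -(He r)//=; first by case: Sr.
  by rewrite ltr_distlC (lt_le_trans _ (ltW sr)) ?rs//= ltrBlDr ltrDl.
exists s; split.
- rewrite sb andbT lt_neqAle as_ andbT; apply/eqP => /(congr1 X).
  by rewrite Xa Xs => /eqP; rewrite -[X in X == _]addn0 -addn1 eqn_add2l.
- move=> r /andP[ar rs].
  have : X r <> k.+1.
    move=> Xr; suff : s <= r by rewrite leNgt rs.
    by apply: ge_inf => //; split => //; rewrite ar (le_trans (ltW rs)).
  have := Xmono a r (lexx _) ar; have := Xmono r s ar (ltW rs).
  by rewrite Xa Xs; lia.
- move=> r /andP[sr rb].
  have := Xmono s r as_ sr; have := Xmono r b (le_trans as_ sr) rb.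
  by rewrite Xb Xs; lia.
Qed.

Lemma sorted_gap (T : Type) (a : seq (R * T)) :
  sorted (fun u v : R * T => u.1 < v.1) a ->
  exists2 e, 0 < e & sorted (fun u v : R * T => u.1 + e < v.1) a.
Proof.
case: a => [|u a]; first by exists 1.
elim: a u => [|v a IH] u /=; first by exists 1.
move=> /andP[uv /IH[e e0 ae]]; exists (Num.min e ((v.1 - u.1) / 2)).
  by rewrite lt_min e0 divr_gt0 ?subr_gt0.
apply/andP; split.
  rewrite (@le_lt_trans _ _ (u.1 + (v.1 - u.1) / 2))//; last lra.
  by rewrite lerD2l ge_min lexx orbT.
apply: sub_path ae => y z /=; apply: le_lt_trans.
by rewrite lerD2l ge_min lexx.
Qed.

(* A gap between successive arrivals ensures that a grid of mesh at most e has at most one arrival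
   per cell. *)
End JumpTimes.

(** * Lists of arrivals and grid events *)

Section Arrivals.
Context {d : measure_display} {Omega : measurableType d} {R : realType}.
Context {P : probability Omega R} {A : finType}.
Variables (x : A) (N : seq A -> R -> {RV P >-> nat}) (rate : seq A -> R).
Hypothesis N_poisson : forall l, nontrivial_loop x l -> poisson_process (rate l) (N l).
Implicit Types (t e : R) (w : Omega) (a : seq (R * seq A)) (c : seq (option (seq A))).

Let before (u v : R * seq A) := u.1 < v.1.
Let before_trans : transitive before.
Proof. by move=> u v y; exact: lt_trans. Qed.

Let clock_le l w s t : nontrivial_loop x l -> 0 <= s -> s <= t -> (N l s w <= N l t w)%N.
Proof. by move=> xl; exact: (poisson_nondecreasing (N_poisson xl)). Qed.

(** Suppose (s, l) is in a but not in b, and let s' be the last time before s listed in b, or 0.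
    According to b the clock of l takes the same value at s' and at s, whereas according to a it
    increases. *)
Let arrivals_sub t w a b : arrivals x N t w a -> arrivals x N t w b -> {subset a <= b}.
Proof.
move=> [_ a2 a3] [_ b2 b3] [s l] ua.
have [/= /andP[s0 st] xl] := a2 _ ua.
apply/negPn/negP => ub.
pose s' := \big[Num.max/0]_(v <- b | v.1 < s) v.1.
have s's : s' < s by rewrite /s'; elim/big_ind: _ => // y z ys zs; rewrite gt_max ys.
have s'0 : 0 <= s' by rewrite /s'; exact: bigmax_ge_id.
have bs v : v \in b -> v.1 < s -> v.1 <= s'.
  by move=> vb vs; rewrite /s'; exact: le_bigmax_seq.
have := a3 l s xl; rewrite (ltW s0) st => /(_ isT).
rewrite (b3 l s xl) ?(ltW s0)//.
have s't : 0 <= s' <= t by rewrite s'0 (le_trans (ltW s's)).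
have := a3 l s' xl s't; rewrite (b3 l s' xl s't).
rewrite [count _ b](@eq_in_count _ _ (fun v => (v.2 == l) && (v.1 <= s))); last first.
  move=> v vb /=; case: eqP => //= vl; apply/idP/idP => [|vs].
    by move=> /le_trans; apply; exact: ltW.
  apply: bs => //; rewrite lt_neqAle vs andbT; apply: contra ub => /eqP <-.
  by rewrite -vl -surjective_pairing.
move=> -> /eqP; rewrite ltn_eqF//; apply: (count_lt_mem ua) => /=.
- by rewrite eqxx lexx.
- by rewrite eqxx -ltNge.
- by move=> v _ /andP[-> /le_trans]; apply; exact: ltW.
Qed.

Lemma arrivals_unique t w a b : arrivals x N t w a -> arrivals x N t w b -> a = b.
Proof.
move=> ha hb; apply: (irr_sorted_eq before_trans).
- by move=> u; exact: ltxx.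
- by case: ha.
- by case: hb.
- by move=> u; apply/idP/idP; apply: arrivals_sub; eassumption.
Qed.

(* The outcomes whose arrivals over each interval ]e * i, e * (i + 1)] are
   exactly: one arrival of l if c_i = Some l, none if c_i = None. *)
Definition grid_event e c : set Omega := [set w | forall l, nontrivial_loop x l ->
  forall i, (i < size c)%N ->
    (N l (e * i.+1%:R) w - N l (e * i%:R) w)%N = (nth None c i == Some l)].

Let grid_event_rcons e c o w : grid_event e (rcons c o) w <->
  grid_event e c w /\ forall l, nontrivial_loop x l ->
    (N l (e * (size c).+1%:R) w - N l (e * (size c)%:R) w)%N = (o == Some l).
Proof.
split=> [cw|[cw ow] l xl i].
  split=> [l xl i ic|l xl].
    by have := cw l xl i; rewrite size_rcons nth_rcons ic => -> //; rewrite ltnW.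
  by have := cw l xl (size c); rewrite size_rcons nth_rcons ltnn eqxx => ->.
rewrite size_rcons ltnS leq_eqVlt nth_rcons => /predU1P[->|ic].
  by rewrite ltnn eqxx; exact: ow.
by rewrite ic; exact: cw.
Qed.

(** The list is built cell by cell. A cell marked [Some l] contributes the jump time of [N l] inside
    it; every other clock is monotone with equal values at both ends of the cell, hence constant
    there. *)
Lemma grid_event_arrivals e c w : 0 < e -> all (nontrivial_loop x) (pmap id c) ->
  grid_event e c w ->
  exists2 a, arrivals x N (e * (size c)%:R) w a & unzip2 a = pmap id c.
Proof.
move=> e0; elim/last_ind: c => [|c o IH] xc.
  move=> _; exists [::] => //; split => // l s xl; rewrite mulr0 => s0 /=.
  have -> : s = 0 by apply/eqP; rewrite eq_le andbC.
  by move/nontrivial_loopsP : xl => /N_poisson/poisson_start.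
move=> /grid_event_rcons[/IH{}IH ow].
move: xc; rewrite -cats1 pmap_cat all_cat => /andP[/IH[a [a1 a2 a3] ac] xo].
rewrite size_cat addn1; set t := e * _ in a2 a3 ow *; set t' := e * _ in ow *.
have tt' : t < t' by rewrite /t /t' ltr_pM2l// ltr_nat.
have t0 : 0 <= t by rewrite mulr_ge0// ltW.
have count_after l r : t <= r ->
    count (fun u => (u.2 == l) && (u.1 <= r)) a = count (fun u => (u.2 == l) && (u.1 <= t)) a.
  move=> tr; apply: eq_in_count => u ua; have [/andP[_ ut] _] := a2 _ ua.
  by rewrite ut (le_trans ut).
have flat l : nontrivial_loop x l -> o != Some l -> forall r, t <= r <= t' ->
    N l r w = N l t w.
  move=> xl ol r /andP[tr rt']; have := ow l xl; rewrite (negbTE ol).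
  have := clock_le w xl t0 tr; have := clock_le w xl (le_trans t0 tr) rt'.
  by move: (N l r w) (N l t w) (N l t' w); clear; lia.
case: o ow xo flat => [l|] ow xo flat.
  have {xo} xl : nontrivial_loop x l by move: xo; rewrite /= andbT.
  have := ow l xl; rewrite eqxx => Xl.
  have [||||s [/andP[ts st'] sl sr]] :=
    @jump_time R (fun r => N l r w) t t' (N l t w) tt'.
  - by move=> r r' tr; apply: clock_le => //; exact: le_trans tr.
  - by move=> r tr; apply: (poisson_right_continuous (N_poisson xl)); exact: le_trans tr.
  - by [].
  - by move: (clock_le w xl t0 (ltW tt')) Xl; move: (N l t w) (N l t' w); clear; lia.
  exists (rcons a (s, l)); last by rewrite /unzip2 map_rcons -cats1 /= -/(unzip2 a) ac.
  split.
  - move: a1; rewrite !(sorted_pairwise before_trans) pairwise_rcons => ->.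
    by rewrite andbT; apply/allP => u /a2[/andP[_ ut] _]; exact: le_lt_trans ts.
  - move=> u; rewrite mem_rcons inE => /predU1P[->|/a2[/andP[u0 ut] ul]] /=.
      by rewrite st' (le_lt_trans t0 ts); split => //; apply/nontrivial_loopsP.
    by rewrite u0 (le_trans ut (ltW tt')).
  - move=> l' r /nontrivial_loopsP xl' /andP[r0 rt']; rewrite -cats1 count_cat /= addn0.
    have [rt|/ltW tr] := leP r t.
      rewrite -a3 ?r0//; last by apply/nontrivial_loopsP.
      by rewrite [s <= r]leNgt (le_lt_trans rt ts) andbF addn0.
    rewrite count_after// -a3 ?t0 ?lexx//; last by apply/nontrivial_loopsP.
    have [<-|ll'] := eqVneq l l'; last first.
      by rewrite addn0; apply: flat => //; rewrite ?tr//; apply: contra ll' => /eqP[->].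
    have [sr'|rs] := leP s r; first by rewrite sr ?sr' ?addn1.
    by rewrite sl ?addn0 ?tr.
exists a; last by rewrite cats0.
split => //.
- by move=> u /a2[/andP[-> ut] ul]; rewrite (le_trans ut (ltW tt')).
- move=> l' r xl' /andP[r0 rt'].
  have [rt|/ltW tr] := leP r t; first by rewrite -a3 ?r0.
  rewrite count_after// -a3 ?t0 ?lexx//; apply: flat; rewrite ?tr//.
  by apply/nontrivial_loopsP.
Qed.

(** Cells are removed from the end. As arrivals are more than e apart, an arrival in the last cell
    puts all earlier ones before that cell. *)
Lemma arrivals_grid_event e n w a : 0 < e -> arrivals x N (e * n%:R) w a ->
  sorted (fun u v : R * seq A => u.1 + e < v.1) a ->
  exists c, [/\ size c = n, pmap id c = unzip2 a & grid_event e c w].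
Proof.
move=> e0; elim: n a => [|n IH] a ha ea.
  exists [::]; split => //; case: ha => _ a2 _; case: a a2 {ea} => // u a a2.
  have [/andP[u0 +] _] := a2 u (mem_head _ _).
  by rewrite mulr0 leNgt u0.
set t := e * n%:R in IH; set t' := e * n.+1%:R in ha.
have tt' : t < t' by rewrite /t /t' ltr_pM2l// ltr_nat.
have t0 : 0 <= t by rewrite mulr_ge0// ltW.
(* Here b is the list of the arrivals before the last cell and o the content of that cell. *)
have step b o : arrivals x N t w b -> sorted (fun u v : R * seq A => u.1 + e < v.1) b ->
    unzip2 a = unzip2 b ++ pmap id [:: o] ->
    (forall l, nontrivial_loop x l -> (N l t' w - N l t w)%N = (o == Some l)) ->
    exists c, [/\ size c = n.+1, pmap id c = unzip2 a & grid_event e c w].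
  move=> hb eb ab ow; have [c [cn cb cw]] := IH b hb eb.
  exists (rcons c o); split; first by rewrite size_rcons cn.
  - by rewrite -cats1 pmap_cat ab cb.
  - by apply/grid_event_rcons; split; rewrite ?cn.
have [a1 a2 a3] := ha.
have ct l : nontrivial_loop x l -> N l t' w = count (fun u => u.2 == l) a.
  move=> xl; rewrite (a3 l t'); [|exact/nontrivial_loopsP|by rewrite lexx (le_trans t0 (ltW tt'))].
  by apply: eq_in_count => u /a2[/andP[_ ->] _]; rewrite andbT.
have early b : {subset b <= a} -> sorted before b -> all (fun u => u.1 <= t) b ->
   (forall l s, s <= t -> count (fun u => (u.2 == l) && (u.1 <= s)) a =
      count (fun u => (u.2 == l) && (u.1 <= s)) b) -> arrivals x N t w b.
  move=> ba sb /allP bt cab; split=> // [u ub|l s xl /andP[s0 st]].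
    by have [/andP[-> _] ul] := a2 _ (ba _ ub); split => //; exact: bt.
  by rewrite a3 ?cab// s0 (le_trans st)// ltW.
have ct0 b l : nontrivial_loop x l -> arrivals x N t w b -> N l t w = count (fun u => u.2 == l) b.
  move=> xl [_ b2 b3]; rewrite (b3 l t); [|exact/nontrivial_loopsP|by rewrite lexx t0].
  by apply: eq_in_count => u /b2[/andP[_ ->] _]; rewrite andbT.
have [at_|] := boolP (all (fun u : R * seq A => u.1 <= t) a).
  have hb : arrivals x N t w a by exact: early.
  apply: (step a None) => // [|l xl]; first by rewrite cats0.
  by rewrite ct// (ct0 a)// subnn.
case/lastP: a ha ea a1 a2 a3 ct early step => // b u ha ea a1 a2 a3 ct early step.
rewrite all_rcons negb_and.
have be : all (fun v => v.1 + e < u.1) b.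
  move: ea; rewrite sorted_pairwise ?pairwise_rcons => [/andP[]//|v y z vy yz].
  by rewrite (lt_trans vy)// (lt_trans _ yz)// ltrDl.
have bt : all (fun v => v.1 <= t) b.
  have ub : u \in rcons b u by rewrite mem_rcons mem_head.
  have [/andP[_ ut'] _] := a2 u ub.
  apply: sub_all be => v vu; rewrite -(lerD2r e) (le_trans (ltW vu))// (le_trans ut')//.
  by rewrite /t' /t -natr1 mulrDr mulr1.
rewrite bt orbF -ltNge => tu.
have hb : arrivals x N t w b.
  apply: early => // [v vb|| l s st].
  - by rewrite mem_rcons inE vb orbT.
  - by move: a1; rewrite !(sorted_pairwise before_trans) pairwise_rcons => /andP[].
  - by rewrite -cats1 count_cat /= [u.1 <= s]leNgt (le_lt_trans st tu) andbF !addn0.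
apply: (step b (Some u.2)) => // [|| l xl].
- by move: ea; rewrite -cats1 => /cat_sorted2[].
- by rewrite /unzip2 map_rcons -cats1.
- by rewrite ct// (ct0 b)// -cats1 count_cat /= addn0 addKn.
Qed.

Definition arrival_event t (es : seq (seq A)) : set Omega :=
  [set w | exists2 a, arrivals x N t w a & unzip2 a = es].

(** A countable union, which makes the event measurable. Every mesh t / n below the smallest gap
    detects the arrivals one by one. The empty word is excluded because it constrains no clock. *)
Lemma arrival_eventE t es : 0 < t -> all (nontrivial_loop x) es ->
  arrival_event t es = \bigcup_(c in [set c | c != [::] /\ pmap id c = es])
    grid_event (t / (size c)%:R) c.
Proof.
move=> t0 xes; apply/seteqP; split=> [w [a ha aes]|w [c [/= c0 ces] cw]].
  have [e e0 ea] : exists2 e, 0 < e & sorted (fun u v : R * seq A => u.1 + e < v.1) a.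
    by apply: sorted_gap; case: ha.
  pose n := Num.truncn (t / e).
  have n0 : 0 < n.+1%:R :> R by [].
  have tn : t / n.+1%:R <= e.
    by rewrite ler_pdivrMr// mulrC -ler_pdivrMr// ltW// truncnS_gt.
  have [|||c [cn ca cw]] := @arrivals_grid_event (t / n.+1%:R) n.+1 w a.
  - by rewrite divr_gt0.
  - by rewrite divfK ?gt_eqF.
  - case: (a) ea => //= u b; apply: sub_path => y z /=.
    by apply: le_lt_trans; rewrite lerD2l.
  exists c; last by rewrite cn.
  by split; [rewrite -size_eq0 cn|rewrite ca].
have n0 : 0 < (size c)%:R :> R by rewrite ltr0n lt0n size_eq0.
have [||a ha ac] := @grid_event_arrivals (t / (size c)%:R) c w _ _ cw.
- by rewrite divr_gt0.
- by rewrite ces.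
exists a; last by rewrite ac.
by rewrite -[t](divfK (lt0r_neq0 n0)).
Qed.


End Arrivals.

(** * Total mass of the arrival weights *)

Lemma prod_natD1 (R : pzRingType) k : \prod_(i < k) (i%:R + 1) = k`!%:R :> R.
Proof.
elim: k => [|k IH]; first by rewrite big_ord0.
by rewrite big_ord_recr/= IH factS natr1 mulnC natrM.
Qed.

Section LoopSoup.
Context {A : finType} {R : realType}.
Variable p : A -> A -> R.
Hypothesis p_ge0 : forall y z, 0 <= p y z.
Hypothesis p_int : integrable_weight p.
Variable x : A.
Implicit Types (l : seq A) (es : seq (seq A)) (t : R).

Local Notation rate := (loop_rate p x).

Let rate_ge0 l : 0 <= rate l.
Proof. exact: loop_rate_ge0. Qed.

Definition total_rate : R :=
  fine (\esum_(l in [set l | nontrivial_loop x l]) (rate l)%:E)%E.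

(** Since m'(l) <= p(l), the total rate is dominated by the finite sum defining the Green
    function. *)
Lemma total_rateE :
  (\esum_(l in [set l | nontrivial_loop x l]) (rate l)%:E)%E = total_rate%:E.
Proof.
rewrite /total_rate fineK// ge0_fin_numE; last by apply: esum_ge0 => l _; rewrite lee_fin.
apply: le_lt_trans (esum_rooted_loops_fin p_ge0 x p_int).
rewrite [leRHS](esumID [set l | nontrivial_loop x l]); last first.
  by move=> l _; rewrite lee_fin path_weight_ge0.
rewrite (_ : _ `&` _ = [set l | nontrivial_loop x l]); last first.
  by apply/seteqP; split => [l []//|l /= xl]; split => //; case/andP: xl.
rewrite -[leLHS]adde0 leeD//; last first.
  by apply: esum_ge0 => l _; rewrite lee_fin path_weight_ge0.
by apply: le_esum => l xl; rewrite lee_fin loop_rate_le.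
Qed.

Definition arrivals_weight t es : R :=
  t ^+ size es / (size es)`!%:R * \prod_(e <- es) rate e.

Lemma arrivals_weight_ge0 t es : 0 <= t -> 0 <= arrivals_weight t es.
Proof.
by move=> t0; rewrite mulr_ge0 ?divr_ge0 ?exprn_ge0//; apply: prodr_ge0.
Qed.

Let esum_prod_rate m :
  (\esum_(es in [set es | size es = m /\ all (nontrivial_loop x) es])
     (\prod_(e <- es) rate e)%:E = (total_rate ^+ m)%:E)%E.
Proof.
have prod_ge0 es : (0 <= (\prod_(e <- es) rate e)%:E)%E by rewrite lee_fin prodr_ge0.
elim: m => [|m IH].
  rewrite (_ : [set es | _] = [set [::]]); last first.
    by apply/seteqP; split => [es [/size0nil]|_ ->].
  by rewrite esum_set1// big_nil expr0.
pose J (l : seq A) := [set es | size es = m /\ all (nontrivial_loop x) es].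
rewrite (@reindex_esum _ _ _ ([set l | nontrivial_loop x l] `*`` J) _
  (fun u => u.1 :: u.2)); last first.
  split.
  - by move=> [l es] [/= xl [<- xes]]; rewrite xl xes.
  - by move=> [l es] [l' es'] _ _ [-> ->].
  - by move=> [|l es] [] //= [sm] /andP[xl xes]; exists (l, es).
under eq_esum do rewrite big_cons EFinM.
rewrite -(esum_esum (a := fun l es => ((rate l)%:E * (\prod_(e <- es) rate e)%:E)%E)); last first.
  by move=> l es _ _; rewrite mule_ge0// lee_fin.
under eq_esum do rewrite esumZl// IH muleC.
have rate0 : 0 <= total_rate.
  by rewrite -lee_fin -total_rateE esum_ge0// => l _; rewrite lee_fin.
by rewrite esumZl ?total_rateE -?EFinM ?exprSr ?exprn_ge0.
Qed.

Lemma esum_arrivals_weight t : 0 <= t ->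
  (\esum_(es in [set es | all (nontrivial_loop x) es]) (arrivals_weight t es)%:E =
   (expR (t * total_rate))%:E)%E.
Proof.
move=> t0; rewrite (_ : [set es | _] =
    \bigcup_m [set es | size es = m /\ all (nontrivial_loop x) es]); last first.
  by apply/seteqP; split => [es xes|es [m _ []]//]; exists (size es).
rewrite nneseries_sum_bigcup; first last.
- by move=> es; rewrite lee_fin arrivals_weight_ge0.
- apply/trivIsetP => i j _ _ /eqP ij; apply/seteqP; split => // es [[si _] [sj _]].
  by apply: ij; rewrite -si -sj.
rewrite /expR -EFin_lim; last exact: is_cvg_series_exp_coeff.
congr (limn _); apply/funext => n.
rewrite /series/= -sumEFin; apply: eq_bigr => m _.
transitivity ((t ^+ m / m`!%:R)%:E * (total_rate ^+ m)%:E)%E; last first.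
  by rewrite -EFinM exp_coeffE exprMn; congr (_%:E); rewrite mulrAC mulrC.
rewrite -esum_prod_rate -esumZl; first last.
- by move=> es; rewrite lee_fin prodr_ge0.
- by rewrite divr_ge0 ?exprn_ge0.
by apply: eq_esum => es [sm _]; rewrite /arrivals_weight sm EFinM.
Qed.

(** Each factor visits x at least once at a positive time, so a loop of order k has at most k
    factors. *)
Definition all_decompositions l : seq (seq (seq A)) :=
  flatten [seq loop_decompositions x m l | m <- iota 0 (count_mem x l).+1].

Lemma mem_all_decompositions l es :
  (es \in all_decompositions l) = all (nontrivial_loop x) es && (flatten es == l).
Proof.
apply/flatten_mapP/idP => [[m _]|].
  by rewrite mem_loop_decompositions => /and3P[_ -> ->].
move=> esl; have em : es \in loop_decompositions x (size es) l.
  by rewrite mem_loop_decompositions eqxx.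
exists (size es) => //; rewrite mem_iota ltnS/=.
exact: loop_decompositions_size em.
Qed.

Lemma all_decompositions_uniq l : uniq (all_decompositions l).
Proof.
rewrite /all_decompositions; move: (count_mem x l).+1 => n.
elim: n 0%N => //= n IH k; rewrite cat_uniq loop_decompositions_uniq IH andbT /=.
apply/hasPn => es /flatten_mapP[m]; rewrite mem_iota => /andP[km _].
rewrite !mem_loop_decompositions => /and3P[/eqP-> _ _].
by rewrite negb_and gt_eqF.
Qed.

(** Each list of nontrivial loops decomposes exactly one sequence, its concatenation, so the sum
    over all lists is only regrouped. *)
Lemma esum_all_decompositions t : 0 <= t ->
  (\esum_(l in [set: seq A]) (\sum_(es <- all_decompositions l) arrivals_weight t es)%:E =
   (expR (t * total_rate))%:E)%E.
Proof.
move=> t0; rewrite -esum_arrivals_weight//.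
have w_ge0 es : (0 <= (arrivals_weight t es)%:E)%E by rewrite lee_fin arrivals_weight_ge0.
rewrite (@reindex_esum _ _ _
  ([set: seq A] `*`` (fun l => [set` all_decompositions l])) _ snd); last first.
  split.
  - by move=> [l es] [_ /=]; rewrite mem_all_decompositions => /andP[].
  - move=> [l es] [l' es']; rewrite !inE => -[_ /=] + [_ /=] + ee'.
    rewrite -ee' !mem_all_decompositions => /andP[_ /eqP<-] /andP[_ /eqP<-].
    by rewrite ee'.
  - move=> es /= xes; exists (flatten es, es) => //; split => //=.
    by rewrite mem_all_decompositions xes/=.
rewrite -(esum_esum (a := fun _ es => (arrivals_weight t es)%:E))//.
by apply: eq_esum => l _; rewrite esum_seq ?all_decompositions_uniq// sumEFin.
Qed.

Lemma sum_all_decompositions t l : rooted_loop x l ->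
  \sum_(es <- all_decompositions l) arrivals_weight t es =
  path_weight p x l *
  (\prod_(i < count_mem x l) (i%:R + t) / (count_mem x l)`!%:R).
Proof.
move=> xl; rewrite /all_decompositions big_flatten big_map.
rewrite -[iota _ _]/(index_iota 0 (count_mem x l).+1) big_mkord.
rewrite -(sum_log_poly_exp t (leqnn _)) mulr_sumr; apply: eq_bigr => m _.
rewrite mulrCA -sum_loop_decompositions//  mulr_sumr.
apply: eq_big_seq => es; rewrite mem_loop_decompositions => /andP[/eqP sm _].
by rewrite /arrivals_weight sm.
Qed.

Lemma greenE : green p x = expR total_rate.
Proof.
have := esum_all_decompositions ler01; rewrite mul1r /green => e.
rewrite -[RHS]/(fine (expR total_rate)%:E) -e; congr fine.
rewrite esum_mkcond; apply: eq_esum => l _.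
case: ifPn => [|xl].
  rewrite inE => xl; rewrite sum_all_decompositions//; congr (_%:E).
  by rewrite prod_natD1 divff ?mulr1// pnatr_eq0 -lt0n fact_gt0.
rewrite big1_seq// => es /=; rewrite mem_all_decompositions => /andP[xes /eqP esl].
move: xl; rewrite notin_setE => -[]; rewrite -esl; apply/eqP/last_flatten.
by apply: sub_all xes => s /andP[].
Qed.

End LoopSoup.

(** * The law of the growing loop *)

Section MeasurableSets.
Context {d : measure_display} {T : measurableType d}.

Lemma countable_bigcup_measurable (I : countType) (D : set I) (F : I -> set T) :
  (forall i, D i -> measurable (F i)) -> measurable (\bigcup_(i in D) F i).
Proof.
move=> DF; rewrite bigcup_mkcond; apply: countable_bigcupT_measurable => // i.
by case: ifPn => // /set_mem; exact: DF.
Qed.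

Lemma countable_bigcap_measurable (I : countType) (D : set I) (F : I -> set T) :
  (forall i, D i -> measurable (F i)) -> measurable (\bigcap_(i in D) F i).
Proof.
move=> DF; rewrite -[X in measurable X]setCK setC_bigcap; apply: measurableC.
by apply: countable_bigcup_measurable => i Di; exact/measurableC/DF.
Qed.

Lemma measurable_subn_fiber (f g : T -> nat) (n : nat) :
  (forall m, measurable [set w | f w = m]) -> (forall m, measurable [set w | g w = m]) ->
  measurable [set w | (f w - g w)%N = n].
Proof.
move=> mf mg; rewrite (_ : [set w | _] =
    \bigcup_(u in [set u : nat * nat | (u.1 - u.2)%N = n])
      ([set w | f w = u.1] `&` [set w | g w = u.2])).
  by apply: countable_bigcup_measurable => u _; exact: measurableI.
apply/seteqP; split => [w <-|w [[a b] /= ab [fa gb]]]; first by exists (f w, g w).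
by rewrite fa gb.
Qed.

Lemma sum_measure_le {R : realType} (mu : {measure set T -> \bar R}) (I : eqType) (s : seq I)
    (F : I -> set T) (B : set T) : uniq s ->
  measurable B -> (forall i, i \in s -> measurable (F i)) ->
  (forall i, i \in s -> F i `<=` B) ->
  (forall i j, i \in s -> j \in s -> i != j -> F i `&` F j `<=` set0) ->
  (\sum_(i <- s) mu (F i) <= mu B)%E.
Proof.
elim: s B => [|i s IH] B; first by rewrite big_nil.
move=> /= /andP[is_ us] mB mF FB F0; rewrite big_cons.
have mFi : measurable (F i) by apply: mF; rewrite mem_head.
rewrite (measureDI mu mB mFi) addeC leeD//.
  apply: IH => //.
  - exact: measurableD.
  - by move=> j js; apply: mF; rewrite inE js orbT.
  - move=> j js w Fjw; split; first by apply: (FB j) => //; rewrite inE js orbT.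
    move=> Fiw; apply: (F0 i j _ _ _ w (conj Fiw Fjw)); rewrite ?mem_head ?inE ?js ?orbT//.
    by apply: contraNneq is_ => ->.
  - by move=> j k js ks; apply: F0; rewrite inE ?js ?ks orbT.
by rewrite setIidr//; apply: FB; rewrite mem_head.
Qed.

End MeasurableSets.

(** * A single Poisson clock on a grid *)

Section PoissonClock.
Context {d : measure_display} {Omega : measurableType d} {R : realType}.
Context {P : probability Omega R}.
Variables (rate : R) (X : R -> {RV P >-> nat}).

(** Parameter 0 must be covered, as rates vanish where p does. The convention 0 ^+ 0 = 1 makes the
    formula agree with the Dirac mass at 0. *)
Lemma poisson_prob_bool (a : R) (b : bool) : 0 <= a ->
  poisson_prob a 0%N [set b : nat] = (a ^+ b * expR (- a))%:E.
Proof.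
rewrite le_eqVlt => /predU1P[<-|a0]; rewrite /poisson_prob.
  rewrite ltxx oppr0 expR0 mulr1 diracE.
  by case: b; [rewrite expr1 memNset|rewrite expr0 mem_set].
rewrite a0 esum_set1; last by rewrite lee_fin poisson_pmf_ge0.
by rewrite /poisson_pmf a0; case: b; rewrite ?fact0 ?invr1 mulr1.
Qed.

(** Places the grid constraints on one clock in its own sigma-algebra, where independence between
    clocks applies. *)
Lemma process_increments_measurable (I : countType) (D : set I) (s t : I -> R) (b : I -> nat) :
  (forall i, D i -> 0 <= s i) -> (forall i, D i -> 0 <= t i) ->
  process_sigma_algebra X
    [set w | forall i, D i -> (X (t i) w - X (s i) w)%N = b i].
Proof.
move=> s0 t0.
rewrite /process_sigma_algebra; set G := bigcup _ _.
have mX r m : 0 <= r -> measurable ([set w | X r w = m] : set (g_sigma_algebraType G)).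
  move=> r0; apply: sub_sigma_algebra; exists r => //.
  by exists [set m] => //; rewrite setTI.
rewrite (_ : mkset _ =
  \bigcap_(i in D) [set w : g_sigma_algebraType G | (X (t i) w - X (s i) w)%N = b i])//.
apply: (@countable_bigcap_measurable _ (g_sigma_algebraType G)) => i Di.
apply: measurable_subn_fiber => m; apply: mX.
  exact: t0.
exact: s0.
Qed.

Hypothesis rate_ge0 : 0 <= rate.
Hypothesis X_poisson : poisson_process rate X.

Lemma poisson_increments_bool (e : R) (b : seq bool) : 0 <= e ->
  P [set w | forall i, (i < size b)%N ->
      (X (e * i.+1%:R) w - X (e * i%:R) w)%N = nth false b i] =
  ((rate * e) ^+ count id b * expR (- (rate * (e * (size b)%:R))))%:E.
Proof.
move=> e0; pose t i : R := e * i%:R.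
have t_ge0 i : 0 <= t i by rewrite mulr_ge0.
have t_homo : {homo t : i j / (i <= j)%N >-> i <= j}.
  by move=> i j ij; rewrite ler_wpM2l// ler_nat.
have := poisson_independent_increments X_poisson (t_ge0 0%N) t_homo.
move=> /(_ [fset i in iota 0 (size b)]%fset
  (fun i => [set w | (X (t i.+1) w - X (t i) w)%N = nth false b i])).
have -> : [set w | forall i, (i < size b)%N ->
      (X (e * i.+1%:R) w - X (e * i%:R) w)%N = nth false b i] =
    \bigcap_(i in [set` [fset i in iota 0 (size b)]%fset])
      [set w | (X (t i.+1) w - X (t i) w)%N = nth false b i].
  apply/seteqP; split => w wb i.
    by rewrite /= !inE mem_iota add0n /= => ib; exact: wb.
  by move=> ib; apply: wb; rewrite /= !inE mem_iota add0n.
move=> -> //; last first.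
  by move=> i _; exists [set nat_of_bool (nth false b i)] => //; rewrite setTI.
rewrite (perm_big (index_iota 0 (size b))); last first.
  by apply: uniq_perm; rewrite ?fset_uniq ?iota_uniq// => i; rewrite !inE mem_index_iota mem_iota.
under eq_bigr => i _.
  rewrite (poisson_increments X_poisson) ?t_homo//.
  rewrite /t -mulrBr -natrB// subSnn mulr1 poisson_prob_bool ?mulr_ge0//.
  over.
rewrite prodEFin; congr (_%:E); rewrite big_split/= prodr_const_nat subn0.
rewrite -expRM_natr mulNr mulrA prodrXr; congr (_ ^+ _ * _).
by rewrite -(big_nth false xpredT (fun i : bool => i : nat)) -sum1_count [RHS]big_mkcond.
Qed.

End PoissonClock.

(** * Placing arrivals in cells *)

Section Spread.
Context {T : eqType}.
Implicit Types (s : seq T) (c : seq (option T)).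

(* The entries of s, in order, spread over n slots; None marks an empty slot. *)
Fixpoint spreads n s : seq (seq (option T)) :=
  if n is n'.+1 then
    map (cons None) (spreads n' s) ++
    (if s is y :: s' then map (cons (Some y)) (spreads n' s') else [::])
  else if s is [::] then [:: [::]] else [::].

Lemma mem_spreads n s c : (c \in spreads n s) = (size c == n) && (pmap id c == s).
Proof.
elim: n s c => [|n IH] s c; first by case: s; case: c => //= -[].
have inS (o : option T) (L : seq (seq (option T))) :
    c \in map (cons o) L = if c is o' :: c' then (o' == o) && (c' \in L) else false.
  case: c => [|o' c']; first by apply/mapP => -[].
  apply/mapP/andP => [[c1 c1L [-> ->]]|[/eqP-> c'L]]; first by rewrite eqxx.
  by exists c'.
rewrite /= mem_cat inS; case: c inS => [|o c] inS.
  by case: s => // y s; rewrite inS.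
rewrite eqSS !IH; case: o inS => [z|] inS /=; last first.
  by case: s => [|y s]; rewrite ?inS ?orbF.
case: s => [|y s]; first by rewrite andbF.
by rewrite inS IH eqseq_cons (inj_eq Some_inj) andbCA.
Qed.

Lemma spreads_uniq n s : uniq (spreads n s).
Proof.
elim: n s => [|n IH] s; first by case: s.
have inj (o : option T) : injective (cons o) by move=> ? ? [].
rewrite /= cat_uniq map_inj_uniq ?IH//=; case: s => // y s.
rewrite map_inj_uniq ?IH// andbT; apply/hasPn => _ /mapP[c _ ->].
by apply/mapP => -[].
Qed.

Lemma size_spreads n s : size (spreads n s) = 'C(n, size s).
Proof.
elim: n s => [|n IH] s; first by case: s.
by rewrite /= size_cat size_map IH; case: s => [|y s] /=; rewrite ?size_map ?IH ?bin0.
Qed.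

End Spread.

Lemma prod_count_mem (R : comPzRingType) (I : choiceType) (K : {fset I}) (s : seq I) (f : I -> R) :
  {subset s <= K} -> \prod_(i <- K) f i ^+ count_mem i s = \prod_(i <- s) f i.
Proof.
elim: s => [|y s IH] sK.
  by rewrite big_nil big1.
rewrite big_cons -IH; last by move=> z zs; apply: sK; rewrite inE zs orbT.
under eq_bigr do rewrite /= exprD.
rewrite big_split/=; congr (_ * _).
have yK : y \in K by apply: sK; rewrite mem_head.
rewrite (bigD1_seq y)//= eqxx expr1 big1 ?mulr1// => i iy.
by rewrite eq_sym (negbTE iy) expr0.
Qed.

Lemma cvg_binomial_ratio (R : realType) (m : nat) :
  ('C(n.+1, m)%:R / n.+1%:R ^+ m @[n --> \oo] --> ((m`!%:R)^-1 : R)).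
Proof.
have ff : (n.+1 ^_ m)%:R / n.+1%:R ^+ m @[n --> \oo] --> (1 : R).
  elim: m => [|m IH].
    by under eq_fun do rewrite ffactn0 expr0 divr1; exact: cvg_cst.
  have -> : (fun n : nat => (n.+1 ^_ m.+1)%:R / n.+1%:R ^+ m.+1 : R) =
      (fun n => (n.+1 ^_ m)%:R / n.+1%:R ^+ m * ((n.+1 - m)%N%:R / n.+1%:R)).
    by apply/funext => n; rewrite ffactnSr natrM exprSr invfM mulrACA.
  rewrite -[X in _ --> X]mulr1; apply: cvgM => //.
  (* The truncated subtraction n + 1 - m agrees with the real one only eventually; n >= m is
     enough. *)
  apply: (@cvg_trans _ ((1 - m%:R * harmonic n) @[n --> \oo])).
    apply: near_eq_cvg; exists m => // n /= mn.
    rewrite natrB; last by rewrite (leq_trans mn).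
    by rewrite mulrBl divff ?pnatr_eq0.
  have : 1 - m%:R * harmonic n @[n --> \oo] --> (1 - m%:R * 0 : R).
    apply: cvgB; first exact: cvg_cst.
    by apply: cvgM; [exact: cvg_cst|exact: cvg_harmonic].
  by rewrite mulr0 subr0.
have -> : (fun n : nat => 'C(n.+1, m)%:R / n.+1%:R ^+ m : R) =
    (fun n => (n.+1 ^_ m)%:R / n.+1%:R ^+ m * (m`!%:R)^-1).
  apply/funext => n; rewrite -bin_ffact natrM mulrAC mulfK// pnatr_eq0 -lt0n fact_gt0.
have := cvgM ff (cvg_cst (m`!%:R^-1 : R)).
by rewrite mul1r; apply.
Qed.

(** * Lower bounds and identification of the law *)

Section GrowingLoopLaw.
Context {d : measure_display} {Omega : measurableType d} {R : realType}.
Context {P : probability Omega R} {A : finType}.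
Variables (p : A -> A -> R) (x : A) (N : seq A -> R -> {RV P >-> nat}).
Hypothesis p_ge0 : forall y z, 0 <= p y z.
Hypothesis p_int : integrable_weight p.
Hypothesis N_clocks : growing_loop_clocks p x N.
Implicit Types (t e : R) (l : seq A) (es : seq (seq A)) (c : seq (option (seq A))).

Local Notation rate := (loop_rate p x).
Local Notation total := (total_rate p x).

Let clock_poisson l : nontrivial_loop x l -> poisson_process (rate l) (N l).
Proof.
move=> xl; apply: N_clocks.1; first exact: count_mem_nontrivial.
by apply: rooted_loop_order; case/andP: xl.
Qed.

Let clock_event e c l : set Omega := [set w | forall i, (i < size c)%N ->
  (N l (e * i.+1%:R) w - N l (e * i%:R) w)%N = (nth None c i == Some l)].

Let clock_event_sigma e c l : 0 <= e -> process_sigma_algebra (N l) (clock_event e c l).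
Proof.
move=> e0.
have := @process_increments_measurable _ _ _ _ (N l) nat [set i | (i < size c)%N]
  (fun i => e * i%:R) (fun i => e * i.+1%:R) (fun i => nth None c i == Some l).
by apply => i _; rewrite mulr_ge0.
Qed.

Let measurable_clock l t (m : nat) : measurable [set w | N l t w = m].
Proof.
have mN : measurable_fun setT (N l t) by [].
by have := mN measurableT [set m] I; rewrite setTI.
Qed.

Let measurable_clock_event e c l : measurable (clock_event e c l).
Proof.
rewrite (_ : clock_event _ _ _ = \bigcap_(i in [set i | (i < size c)%N])
  [set w | (N l (e * i.+1%:R) w - N l (e * i%:R) w)%N = (nth None c i == Some l)])//.
apply: countable_bigcap_measurable => i _; apply: measurable_subn_fiber => m.
  exact: measurable_clock.
exact: measurable_clock.
Qed.

Let clock_event_prob e c l : 0 <= e -> nontrivial_loop x l ->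
  P (clock_event e c l) =
  ((rate l * e) ^+ count_mem l (pmap id c) * expR (- (rate l * (e * (size c)%:R))))%:E.
Proof.
move=> e0 xl.
have := poisson_increments_bool (loop_rate_ge0 p_ge0 x l) (clock_poisson xl)
  [seq o == Some l | o <- c] e0.
rewrite size_map count_map => H.
transitivity (P [set w | forall i, (i < size c)%N ->
  (N l (e * i.+1%:R) w - N l (e * i%:R) w)%N = nth false [seq o == Some l | o <- c] i]).
  congr (P _); apply/seteqP; split => w cw i ic.
    by rewrite (nth_map None)//; exact: cw.
  by have := cw i ic; rewrite (nth_map None).
rewrite H; congr ((_ ^+ _ * _)%:E).
by elim: (c) => //= -[y|] c' IH //=; rewrite IH.
Qed.

Let measurable_grid_event e c : measurable (grid_event x N e c).
Proof.
rewrite (_ : grid_event _ _ _ _ =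
    \bigcap_(l in [set l | nontrivial_loop x l]) clock_event e c l)//.
by apply: countable_bigcap_measurable => l _.
Qed.

Let clock_events_prob (K : {fset seq A}) e c : 0 <= e ->
  {in K, forall l, nontrivial_loop x l} -> {subset pmap id c <= K} ->
  P (\bigcap_(l in [set` K]) clock_event e c l) =
  (\prod_(l <- pmap id c) (rate l * e) *
   expR (- ((\sum_(l <- K) rate l) * (e * (size c)%:R))))%:E.
Proof.
move=> e0 xK cK; rewrite N_clocks.2; first last.
- by move=> l lK; exact: clock_event_sigma.
- by move=> l lK; apply/nontrivial_loopsP; exact: xK.
rewrite big_seq; under eq_bigr => l lK do rewrite clock_event_prob ?xK//.
rewrite -big_seq prodEFin big_split/= prod_count_mem//.
by rewrite -expR_sum mulr_suml -sumrN.
Qed.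

Lemma sum_rate_le (K : {fset seq A}) : {in K, forall l, nontrivial_loop x l} ->
  \sum_(l <- K) rate l <= total.
Proof.
move=> xK; rewrite -lee_fin -(total_rateE p_ge0 p_int) -sumEFin.
apply: esum_ge; exists [set` K]; first by split => //; move=> l; exact: xK.
by rewrite fsbig_seq ?fset_uniq.
Qed.

(** The grid event is the decreasing intersection of the events [F n], each involving finitely many
    clocks. Independence gives each of them at least the stated probability, and continuity from
    above transfers the bound. *)
Let grid_event_prob_ge e c : 0 <= e -> all (nontrivial_loop x) (pmap id c) ->
  ((\prod_(l <- pmap id c) (rate l * e) * expR (- (total * (e * (size c)%:R))))%:E <=
   P (grid_event x N e c))%E.
Proof.
move=> e0 /allP xc.
(* The loops of c belong to every [K n], so the product over the arrivals is complete from the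
   start; unpickling exhausts the remaining loops. *)
pose K n := [fset l in pmap id c ++ pmap choice.unpickle (iota 0 n) | nontrivial_loop x l]%fset.
pose F n := \bigcap_(l in [set` K n]) clock_event e c l.
have KS n : {subset K n <= K n.+1}.
  move=> l; rewrite !inE !mem_cat => /andP[/orP[->//|ln] ->]; rewrite andbT; apply/orP; right.
  by rewrite -(addn1 n) iotaD pmap_cat mem_cat ln.
have FE : grid_event x N e c = \bigcap_n F n.
  apply/seteqP; split => [w cw n _ l /= lK|w cw l xl].
    by apply: cw; move: lK; rewrite !inE => /andP[].
  apply: (cw (choice.pickle l).+1) => //=; rewrite !inE xl andbT mem_cat; apply/orP; right.
  rewrite mem_pmap; apply/mapP; exists (choice.pickle l); last by rewrite choice.pickleK.
  by rewrite mem_iota/=.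
have mF n : measurable (F n) by apply: countable_bigcap_measurable.
have FP n : ((\prod_(l <- pmap id c) (rate l * e) * expR (- (total * (e * (size c)%:R))))%:E <=
   P (F n))%E.
  have xK : {in K n, forall l, nontrivial_loop x l} by move=> l; rewrite !inE => /andP[].
  rewrite clock_events_prob//; last by move=> l lc; rewrite !inE mem_cat lc xc.
  rewrite lee_fin ler_wpM2l//.
    by apply: prodr_ge0 => l _; rewrite mulr_ge0// loop_rate_ge0.
  by rewrite ler_expR lerN2 ler_wpM2r ?mulr_ge0// sum_rate_le.
have cF : P \o F @ \oo --> P (grid_event x N e c).
  rewrite FE; apply: nonincreasing_cvg_mu => //.
  - by rewrite (le_lt_trans (probability_le1 _ _))// ltry.
  - by rewrite -FE.
  - apply/nonincreasing_seqP => n; apply/subsetPset => w Fw l lK; apply: Fw; exact: KS.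
have <- : limn (P \o F) = P (grid_event x N e c) by apply/cvg_lim.
apply: lime_ge; first by apply/cvg_ex; eexists; exact: cF.
by apply: nearW.
Qed.

Let measurable_arrival_event t es : 0 < t -> all (nontrivial_loop x) es ->
  measurable (arrival_event x N t es).
Proof.
move=> t0 xes; rewrite (arrival_eventE clock_poisson t0 xes).
by apply: countable_bigcup_measurable.
Qed.

(** If c has l in cell i, the clock of l increases by 1 there, which forces c' to have l in that
    cell too; the argument is symmetric. *)
Let grid_event_disjoint e n es c c' : all (nontrivial_loop x) es ->
  c \in spreads n es -> c' \in spreads n es -> c != c' ->
  grid_event x N e c `&` grid_event x N e c' `<=` set0.
Proof.
move=> /allP xes; rewrite !mem_spreads => /andP[/eqP cn /eqP ces] /andP[/eqP cn' /eqP ces'].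
move=> /eqP cc' w [cw cw']; apply: cc'.
have agree c1 c2 i l : size c1 = n -> pmap id c1 = es -> size c2 = n ->
    grid_event x N e c1 w -> grid_event x N e c2 w -> (i < n)%N ->
    nth None c1 i = Some l -> nth None c2 i = Some l.
  move=> s1 c1es s2 w1 w2 i_n c1l.
  have xl : nontrivial_loop x l.
    by apply: xes; rewrite -c1es mem_pmap map_id -c1l mem_nth// s1.
  have := w2 l xl i; rewrite s2 => /(_ i_n); rewrite (w1 l xl i) ?s1// c1l eqxx.
  by case: eqP.
apply: (@eq_from_nth _ None); first by rewrite cn cn'.
move=> i; rewrite cn => i_n.
case c'l : (nth None c' i) => [l|]; first by rewrite (agree c' c i l).
by case cl : (nth None c i) => [l|//]; rewrite -c'l (agree c c' i l).
Qed.

Lemma arrival_event_prob_ge t es : 0 < t -> all (nontrivial_loop x) es ->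
  ((expR (- (t * total)) * arrivals_weight p x t es)%:E <= P (arrival_event x N t es))%E.
Proof.
move=> t0 xes; set E := arrival_event x N t es.
have mE : measurable E by exact: measurable_arrival_event.
pose m := size es; pose W := \prod_(l <- es) rate l.
(* The number of ways to place m arrivals in n + 1 cells, times the lower bound common to all
   placements. *)
pose v n : R := 'C(n.+1, m)%:R / n.+1%:R ^+ m * (t ^+ m * W * expR (- (t * total))).
have vP n : ((v n)%:E <= P E)%E.
  have n0 : n.+1%:R != 0 :> R by rewrite pnatr_eq0.
  apply: (@le_trans _ _ (\sum_(c <- spreads n.+1 es) P (grid_event x N (t / n.+1%:R) c))%E).
    apply: (@le_trans _ _ (\sum_(c <- spreads n.+1 es)
        (n.+1%:R ^- m * (t ^+ m * W * expR (- (t * total))))%:E)%E); last first.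
      rewrite !big_seq; apply: lee_sum => c; rewrite mem_spreads => /andP[/eqP cn /eqP ces].
      have := @grid_event_prob_ge (t / n.+1%:R) c; rewrite cn ces divfK//.
      rewrite divr_ge0 ?(ltW t0)// => /(_ isT xes); apply: le_trans.
      rewrite lee_fin big_split/= big_const_seq count_predT iter_mulr_1 -/m -/W.
      by rewrite exprMn exprVn (mulrC total) le_eqVlt; apply/orP; left; apply/eqP; ring.
    rewrite sumEFin big_const_seq count_predT size_spreads iter_addr addr0 -/m.
    by rewrite lee_fin /v -[leRHS]mulr_natl [leRHS]mulrA.
  apply: sum_measure_le => //.
  - exact: spreads_uniq.
  - move=> c; rewrite mem_spreads => /andP[/eqP cn /eqP ces].
    rewrite /E (arrival_eventE clock_poisson t0 xes) => w cw; exists c; last by rewrite cn.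
    by split => //; rewrite -size_eq0 cn.
  - by move=> c c' cn cn' cc'; exact: grid_event_disjoint xes cn cn' cc'.
have PE : P E = (fine (P E))%:E by rewrite fineK// fin_num_measure.
have cv : v n @[n --> \oo] --> arrivals_weight p x t es * expR (- (t * total)).
  have -> : arrivals_weight p x t es * expR (- (t * total)) =
      (m`!%:R)^-1 * (t ^+ m * W * expR (- (t * total))).
    by rewrite /arrivals_weight -/m -/W; ring.
  by apply: cvgM; [exact: cvg_binomial_ratio|exact: cvg_cst].
rewrite PE lee_fin mulrC -(cvg_lim _ cv)//; apply: limr_le.
  by apply/cvg_ex; eexists; exact: cv.
by apply: nearW => n; rewrite -lee_fin -PE.
Qed.

Let growing_loop_arrivals t w a : arrivals x N t w a ->
  growing_loop x N t w = flatten (unzip2 a).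
Proof.
move=> ha; rewrite /growing_loop; congr (flatten (unzip2 _)).
by apply: (arrivals_unique _ ha); apply: xgetPex; exists a.
Qed.

Let arrivals_nontrivial t w a : arrivals x N t w a -> all (nontrivial_loop x) (unzip2 a).
Proof.
case=> _ a2 _; apply/allP => _ /mapP[u ua ->]; apply/nontrivial_loopsP.
by have [] := a2 _ ua.
Qed.

(** Outcomes without a list of arrivals take the default value, hence the complement that joins the
    event of the trivial loop. *)
Let growing_loop_setE t l : [set w | growing_loop x N t w = l] =
  \bigcup_(es in [set es | all (nontrivial_loop x) es /\ flatten es = l])
     arrival_event x N t es `|`
  (if l is [::] then
     ~` \bigcup_(es in [set es | all (nontrivial_loop x) es]) arrival_event x N t es
   else set0).
Proof.
apply/seteqP; split => w /=.
  have [[a ha]|na] := pselect (exists a, arrivals x N t w a).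
    rewrite (growing_loop_arrivals ha) => al; left; exists (unzip2 a); last by exists a.
    by split => //; exact: arrivals_nontrivial ha.
  rewrite /growing_loop xgetPN => [<-|a ha]; last by apply: na; exists a.
  by right => -[es _ [a ha _]]; apply: na; exists a.
case=> [[es [xes <-] [a ha <-]]|]; first exact: growing_loop_arrivals.
case: l => // nw; rewrite /growing_loop xgetPN// => a ha; apply: nw.
by exists (unzip2 a); [exact: arrivals_nontrivial ha|exists a].
Qed.

Lemma measurable_growing_loop t l : 0 < t -> measurable [set w | growing_loop x N t w = l].
Proof.
move=> t0; rewrite growing_loop_setE; apply: measurableU.
  by apply: countable_bigcup_measurable => es [xes _]; exact: measurable_arrival_event.
case: l => //; apply: measurableC; apply: countable_bigcup_measurable => es xes.
exact: measurable_arrival_event.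
Qed.

Let loop_law_lower t l : R :=
  expR (- (t * total)) * \sum_(es <- all_decompositions x l) arrivals_weight p x t es.

Let loop_law_lowerP t l : 0 < t ->
  ((loop_law_lower t l)%:E <= growing_loop_law x N t l)%E.
Proof.
move=> t0; rewrite /loop_law_lower mulr_sumr -sumEFin.
apply: (@le_trans _ _ (\sum_(es <- all_decompositions x l) P (arrival_event x N t es))%E).
  rewrite !big_seq; apply: lee_sum => es; rewrite mem_all_decompositions => /andP[xes _].
  exact: arrival_event_prob_ge.
apply: sum_measure_le.
- exact: all_decompositions_uniq.
- exact: measurable_growing_loop.
- move=> es; rewrite mem_all_decompositions => /andP[xes _].
  exact: measurable_arrival_event.
- move=> es; rewrite mem_all_decompositions => /andP[_ /eqP<-] w [a ha <-].
  exact: growing_loop_arrivals.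
- move=> es es' _ _ /eqP ee' w [[a ha aes] [b hb bes]]; apply: ee'.
  by rewrite -aes -bes (arrivals_unique ha hb).
Qed.

(* The lower bounds add up to 1, so none of them can be strict. *)
Lemma growing_loop_lawE t l : 0 < t -> growing_loop_law x N t l = (loop_law_lower t l)%:E.
Proof.
move=> t0; apply/eqP; rewrite eq_le loop_law_lowerP// andbT.
have lower_ge0 l' : 0 <= loop_law_lower t l'.
  by rewrite mulr_ge0 ?expR_ge0// sumr_ge0// => es _; rewrite arrivals_weight_ge0// ltW.
have sum1 : (\esum_(l' in [set: seq A]) (loop_law_lower t l')%:E = 1)%E.
  under eq_esum do rewrite EFinM.
  rewrite esumZl ?expR_ge0// => [|l']; last first.
    by rewrite lee_fin sumr_ge0// => es _; rewrite arrivals_weight_ge0// ltW.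
  by rewrite esum_all_decompositions ?ltW// -EFinM mulrC expRxMexpNx_1.
have law_sum1 : (\esum_(l' in [set: seq A]) growing_loop_law x N t l' <= 1)%E.
  apply: ge_ereal_sup => _ [X [finX _] <-].
  rewrite fsbig_finite//= -(probability_setT P); apply: sum_measure_le => //.
  - exact: fset_uniq.
  - by move=> l' _; exact: measurable_growing_loop.
  - by move=> l' l'' _ _ /eqP ll w [/= e1 e2]; apply: ll; rewrite -e1 -e2.
have law_ge0 l' : (0 <= growing_loop_law x N t l')%E by exact: measure_ge0.
have split (f : seq A -> \bar R) : (forall l', 0 <= f l')%E ->
    (\esum_(l' in [set: seq A]) f l' = f l + \esum_(l' in ~` [set l]) f l')%E.
  by move=> f0; rewrite (esumID [set l])// !setTI esum_set1.
set rest := (\esum_(l' in ~` [set l]) (loop_law_lower t l')%:E)%E.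
have rest_fin : rest \is a fin_num.
  rewrite ge0_fin_numE; last by apply: esum_ge0 => l' _; rewrite lee_fin.
  apply: (@le_lt_trans _ _ 1%E); last exact: ltry.
  by rewrite -sum1 split ?leeDr ?lee_fin// => l'; rewrite lee_fin.
(* Finiteness of [rest] permits cancellation in \bar R. The claim becomes law(l) + rest <= 1, and
   [rest] is at most the sum of the laws of the other loops. *)
rewrite -(leeD2rE _ _ rest_fin).
rewrite -(split (fun l' => (loop_law_lower t l')%:E)); last by move=> l'; rewrite lee_fin.
rewrite sum1; apply: le_trans law_sum1; rewrite split// leeD2l//.
by apply: le_esum => l' _; exact: loop_law_lowerP.
Qed.

Lemma growing_loop_law_order t k l : 0 < t -> loops_of_order x k l ->
  growing_loop_law x N t l =
  (expR (- (t * total)) *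
   (path_weight p x l * (\prod_(i < k) (i%:R + t) / k`!%:R)))%:E.
Proof.
move=> t0 /loops_of_orderP[xl <-].
by rewrite growing_loop_lawE// /loop_law_lower sum_all_decompositions.
Qed.

End GrowingLoopLaw.

Theorem proposition5p3 (R : realType) (A : finType) (x : A) (p : A -> A -> R)
    (p_ge0 : forall y z, 0 <= p y z) (p_int : integrable_weight p)
    (d : measure_display) (Omega : measurableType d) (P : probability Omega R)
    (N : seq A -> R -> {RV P >-> nat}) (N_clocks : growing_loop_clocks p x N) :
  (forall t : R, 0 < t ->
     (forall l : seq A, measurable [set w | growing_loop x N t w = l]) /\
     (forall (k : nat) (l : seq A), loops_of_order x k l ->
        growing_loop_law x N t l =
          ((green p x `^ t)^-1 * (Gamma (k%:R + t) / (k`!%:R * Gamma t))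
             * path_weight p x l)%:E)) /\
  (forall (k : nat) (l : seq A), loops_of_order x k l ->
     growing_loop_law x N 1 l = (path_weight p x l / green p x)%:E).
Proof.
have law t : 0 < t -> forall (k : nat) (l : seq A), loops_of_order x k l ->
    growing_loop_law x N t l =
    ((green p x `^ t)^-1 * (Gamma (k%:R + t) / (k`!%:R * Gamma t)) * path_weight p x l)%:E.
  move=> t0 k l kl; rewrite (growing_loop_law_order p_ge0 p_int N_clocks t0 kl).
  rewrite greenE// -expRM Gamma_natD// expRN (mulrC t); congr (_%:E).
  have G0 : Gamma t != 0 by rewrite gt_eqF ?Gamma_gt0.
  have f0 : k`!%:R != 0 :> R by rewrite pnatr_eq0 -lt0n fact_gt0.
  move: (\prod_(i < k) _) (k`!%:R) f0 => c f f0.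
  by field; rewrite f0 G0 expR_eq0.
split=> [t t0|k l kl].
  by split=> [l|]; [exact: measurable_growing_loop N_clocks _ _ t0|exact: law].
(* At t = 1 the rising product is k! itself, so Gamma need not be evaluated at 1. *)
rewrite (growing_loop_law_order p_ge0 p_int N_clocks ltr01 kl) greenE// prod_natD1.
by rewrite divff ?mulr1 ?pnatr_eq0 -?lt0n ?fact_gt0// mul1r expRN mulrC.
Qed.
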